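(* Let $1\le k\le n$ and let $\xi_0,\dots,\xi_n$ be independent real random variables with densities $f_0,\dots,f_n$. For distinct $x_1,\dots,x_k\in\mathbb R$, $\mathbf x=(x_1,\dots,x_k)$, the $k$-correlation function of the real zeros of $P_n=\sum_{i=0}^n\xi_ip_i$ satisfies $$\rho_k(\mathbf x)=\prod_{m=0}^n\gamma_m^{-1}\prod_{1\le i<j\le k}|x_i-x_j|\int_{\mathbb R^{n-k+1}}\prod_{l=0}^nf_l\Big(\sum_{i=l}^n\Big(\sum_{j=0}^{n-k}(-1)^{k-i+j}\sigma_{k-i+j}(\mathbf x)t_j\Big)\langle x^i,p_l\rangle_\mu\Big)\prod_{i=1}^k\Big|\sum_{j=0}^{n-k}t_jx_i^j\Big|\,dt_0\cdots dt_{n-k}.$$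
   Context: $\{p_i\}$ are orthonormal polynomials w.r.t. a measure $\mu$ on $\mathbb R$ with all moments finite, $p_i(x)=\gamma_ix^i+\dots$, $\gamma_i>0$; $\langle p,q\rangle_\mu=\int pq\,d\mu$. $\sigma_i(\mathbf x)=\sum_{1\le j_1<\dots<j_i\le k}x_{j_1}\cdots x_{j_i}$ are the elementary symmetric polynomials, with $\sigma_0=1$ and $\sigma_i=0$ for $i<0$ or $i>k$. The $k$-correlation function $\rho_k$ is defined by $\mathbb E\sum G(\zeta_{i_1},\dots,\zeta_{i_k})=\int_{\mathbb R^k}G\rho_k$ for all continuous compactly supported $G$, the sum over $k$-tuples of distinct real zeros of $P_n$. *)

(* Defs.v *)
From HB Require Import structures.
From mathcomp Require Import all_boot all_order all_algebra.
From mathcomp Require Import all_classical all_reals all_analysis.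

Set Implicit Arguments.
Unset Strict Implicit.
Unset Printing Implicit Defensive.

Import Order.TTheory GRing.Theory Num.Theory.
Import numFieldNormedType.Exports.

Local Open Scope classical_set_scope.
Local Open Scope ring_scope.

Section Defs.
Variable R : realType.

Definition esym (k : nat) (x : 'I_k -> R) (m : int) : R :=
  match m with
  | Posz m' => \sum_(A : {set 'I_k} | #|A| == m') \prod_(i in A) x i
  | Negz _ => 0
  end.

Definition cons_pt (m : nat) (s : R) (t : 'I_m -> R) : 'I_m.+1 -> R :=
  fun i => match unlift ord0 i with Some j => t j | None => s end.

Fixpoint iint (m : nat) : (('I_m -> R) -> \bar R) -> \bar R :=
  match m with
  | 0 => fun F => F (fun _ => 0)
  | m'.+1 => fun F =>
      (\int[@lebesgue_measure R]_(s in setT)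
          iint (fun t : 'I_m' -> R => F (cons_pt s t)))%E
  end.

Definition randpoly (Omega : Type) (n : nat) (xi : nat -> Omega -> R)
  (p : nat -> {poly R}) (w : Omega) : {poly R} :=
  \sum_(i < n.+1) xi i w *: p i.

(* sum of G over all k-tuples of distinct real zeros of the polynomial P;
   (convention: 0 when P is the zero polynomial, an event of probability 0) *)
Definition sum_over_zero_tuples (k : nat) (P : {poly R})
  (G : 'rV[R]_k -> R) : R :=
  if P != 0 then
    (\sum_(x \in [set x : 'rV[R]_k |
                 (forall i, root P (x ord0 i)) /\ injective (x ord0)]) G x)%R
  else 0.

Definition cont_compact_supp (k : nat) (G : 'rV[R]_k -> R) : Prop :=
  continuous G /\ compact (closure [set x | G x != 0]).

Definition is_k_correlation (d : measure_display) (Omega : measurableType d)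
  (P : probability Omega R) (n k : nat) (xi : nat -> Omega -> R)
  (p : nat -> {poly R}) (rho : 'rV[R]_k -> \bar R) : Prop :=
  forall G : 'rV[R]_k -> R, cont_compact_supp G ->
    (\int[P]_w (@sum_over_zero_tuples k (randpoly n xi p w) G)%:E)%E
    = iint (fun t : 'I_k -> R => ((G (\row_i t i))%:E * rho (\row_i t i))%E).

Definition ip (mu : {measure set (measurableTypeR R) -> \bar R})
  (f g : R -> R) : R := Rintegral mu setT (fun x => f x * g x).

Definition rho_formula (mu : {measure set (measurableTypeR R) -> \bar R})
  (p : nat -> {poly R}) (f : nat -> R -> R) (n k : nat)
  (x : 'rV[R]_k) : \bar R :=
  let xs := x ord0 in
  ((\prod_(m < n.+1) (lead_coef (p m))^-1 *
    \prod_(i < k) \prod_(j < k | (i < j)%N) `|xs i - xs j|)%:E *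
   iint (fun t : 'I_(n - k).+1 -> R =>
     ((\prod_(l < n.+1)
         f l (\sum_(l <= i < n.+1)
                (\sum_(j < (n - k).+1)
                   (-1) ^ ((k%:Z - i%:Z + j%:Z)%R) *
                   esym xs (k%:Z - i%:Z + j%:Z)%R * t j)
                * ip mu (fun y => y ^+ i) (fun y => (p l).[y])))
      * \prod_(i < k) `|\sum_(j < (n - k).+1) t j * xs i ^+ j|)%:E))%E.

End Defs.

(* Main.v *)
(** The expectation is an integral over the coefficients [a] of the random
    polynomial in the monomial basis; these are a triangular image of the [xi_l], with
    diagonal [1 / gamma_l], so the substitution costs the factor [\prod 1 / gamma_m].
    A polynomial with [k] marked distinct roots [x_i] is [\prod (X - x_i) * q_t] for a
    unique [q_t = \sum_j t_j X^j], and the Jacobian of [(x, t) |-> a] is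
    [\prod_(i < j) |x_i - x_j| * \prod_i |q_t(x_i)|]. No multivariate change of
    variables is needed: writing [a(X) = a_0 + X b(X)], the map from a root [x] to
    [a_0 = - x b(x)] is a polynomial of one variable, to which the area formula
    applies, and passing from [b] to the quotient of [a] by [X - x] is unitriangular.
    Removing the roots one by one in this way yields the Jacobian. *)

Require Import Defs.
From HB Require Import structures.
From mathcomp Require Import all_boot all_order all_algebra.
From mathcomp Require Import all_classical all_reals all_analysis.
From mathcomp Require Import measurable_realfun.
From mathcomp Require Import polyrcf zify lra.
Import Order.TTheory GRing.Theory Num.Theory.
Import numFieldNormedType.Exports.
Local Open Scope classical_set_scope.
Local Open Scope ring_scope.

Set Implicit Arguments.
Unset Strict Implicit.
Unset Printing Implicit Defensive.

(** * Lebesgue measure on R^m and iterated integrals *)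

(** [rho_formula] may a priori be [+oo], so the identities are proved for nonnegative extended-real
    functions, where Tonelli asks only for measurability. The main obstacle is then the
    measurability, in the coefficients, of a sum over the real roots: the roots are listed
    increasingly and each is described by countably many rational conditions. The area formula is an
    equality of two measures in the root variable, checked on half-open intervals. Repeated roots
    are suppressed by the test function rather than by the sums, so that every sum over tuples is an
    iterated sum over one list. Signed test functions enter only at the end: they are bounded and
    the number of roots is bounded, so the expectations of their positive and negative parts are
    finite and can be subtracted. *)

(* An alias of ['I_m -> R], the type [iint] integrates over, so that it can carry
   the sigma-algebra generated by the coordinates. *)
Definition Rn (R : realType) (m : nat) := 'I_m -> R.

Section Rn_measurable.
Variables (R : realType) (m : nat).

HB.instance Definition _ := Pointed.copy (Rn R m) ('I_m -> R).

Let coord : 'I_m -> Rn R m -> R := fun i x => x i.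

Let Rn_set0 : g_sigma_preimage coord set0.
Proof. exact: sigma_algebra0. Qed.

Let Rn_setC A : g_sigma_preimage coord A -> g_sigma_preimage coord (~` A).
Proof. exact: sigma_algebraC. Qed.

Let Rn_bigcup (F : (set (Rn R m))^nat) :
  (forall i, g_sigma_preimage coord (F i)) ->
  g_sigma_preimage coord (\bigcup_i (F i)).
Proof. exact: sigma_algebra_bigcup. Qed.

HB.instance Definition _ := @isMeasurable.Build default_measure_display
  (Rn R m) (g_sigma_preimage coord) Rn_set0 Rn_setC Rn_bigcup.

Lemma measurable_coord (i : 'I_m) : measurable_fun [set: Rn R m] (fun x => x i).
Proof.
move=> _ Y mY; rewrite setTI; apply: sub_sigma_algebra => /=.
rewrite -bigcup_seq/=; exists i => /=; first by rewrite mem_index_enum.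
by exists Y => //; rewrite setTI.
Qed.

Lemma measurable_RnP d (T : measurableType d) (f : T -> Rn R m) :
  (forall i, measurable_fun setT (fun t => f t i)) -> measurable_fun setT f.
Proof.
move=> mf _ A mA; rewrite setTI.
have : preimage_set_system setT f (g_sigma_preimage coord) `<=` measurable.
  rewrite -g_sigma_preimage_comp; apply: smallest_sub.
    exact: sigma_algebra_measurable.
  rewrite -bigcup_seq; apply: bigcup_sub => i _ B [C mC <-].
  exact: mf.
by apply; exists A => //; rewrite setTI.
Qed.

End Rn_measurable.

Section cons_pt.
Variable R : realType.

Lemma cons_pt0 m (s : R) (t : 'I_m -> R) : cons_pt s t ord0 = s.
Proof. by rewrite /cons_pt unlift_none. Qed.

Lemma cons_ptS m (s : R) (t : 'I_m -> R) i : cons_pt s t (lift ord0 i) = t i.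
Proof. by rewrite /cons_pt liftK. Qed.

Lemma cons_ptK m (s : R) (t : 'I_m -> R) :
  (fun i => cons_pt s t (lift ord0 i)) = t.
Proof. by apply/funext => i; rewrite cons_ptS. Qed.

Lemma cons_pt_eta m (x : 'I_m.+1 -> R) :
  cons_pt (x ord0) (fun i => x (lift ord0 i)) = x.
Proof.
apply/funext => i; case: (unliftP ord0 i) => [j|] ->.
  by rewrite cons_ptS.
by rewrite cons_pt0.
Qed.

Lemma measurable_cons_pt d (T : measurableType d) m (s : T -> R)
    (t : T -> Rn R m) :
  measurable_fun setT s -> measurable_fun setT t ->
  measurable_fun setT (fun x => cons_pt (s x) (t x) : Rn R m.+1).
Proof.
move=> ms mt; apply: measurable_RnP => i; case: (unliftP ord0 i) => [j|] ->.
  under eq_fun do rewrite cons_ptS.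
  exact: (measurableT_comp (measurable_coord j) mt).
by under eq_fun do rewrite cons_pt0.
Qed.

Definition consn m (z : measurableTypeR R * Rn R m) : Rn R m.+1 :=
  cons_pt z.1 z.2.

Lemma measurable_consn m : measurable_fun setT (@consn m).
Proof. exact: (measurable_cons_pt measurable_fst measurable_snd). Qed.

End cons_pt.

Section lebn_succ.
Variables (R : realType) (m : nat).
Variable mu : {sigma_finite_measure set (Rn R m) -> \bar R}.

Definition lebn_succ : set (Rn R m.+1) -> \bar R :=
  pushforward (@lebesgue_measure R \x mu)%E (@consn R m).

Let pushm : {measure set (Rn R m.+1) -> \bar R} :=
  measure_function_pushforward__canonical__measure_function_Measure
    (@lebesgue_measure R \x mu)%E (@measurable_consn R m).

Let lebn_succ0 : lebn_succ set0 = 0%E. Proof. exact: (measure0 pushm). Qed.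

Let lebn_succ_ge0 A : (0 <= lebn_succ A)%E. Proof. exact: (measure_ge0 pushm). Qed.

Let lebn_succ_sigma_additive : semi_sigma_additive lebn_succ.
Proof. exact: (@measure_semi_sigma_additive _ _ _ pushm). Qed.

HB.instance Definition _ := isMeasure.Build _ _ _ lebn_succ
  lebn_succ0 lebn_succ_ge0 lebn_succ_sigma_additive.

Let lebn_succ_sigma_finite : sigma_finite setT lebn_succ.
Proof.
have /sigma_finiteP[F [TF ndF Foo]] := sigma_finiteT (@lebesgue_measure R).
have /sigma_finiteP[G [TG ndG Goo]] := sigma_finiteT mu.
have consK (A : set (measurableTypeR R * Rn R m)) :
    @consn R m @^-1` ((fun x => (x ord0, fun i => x (lift ord0 i))) @^-1` A) = A.
  by apply/seteqP; split=> -[s t] /=; rewrite /consn/= cons_pt0 cons_ptK.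
have msplit : measurable_fun setT (fun x : Rn R m.+1 =>
    (x ord0 : measurableTypeR R, (fun i => x (lift ord0 i)) : Rn R m)).
  apply: measurable_fun_pair; first exact: measurable_coord.
  by apply: measurable_RnP => i; exact: measurable_coord.
exists (fun n => (fun x => (x ord0, fun i => x (lift ord0 i))) @^-1` (F n `*` G n)).
  rewrite -preimage_bigcup; apply/seteqP; split => // x _ /=.
  have [n _ Fn] : (\bigcup_n F n) (x ord0) by rewrite -TF.
  have [k _ Gk] : (\bigcup_n G n) (fun i => x (lift ord0 i)) by rewrite -TG.
  (* Both exhausting sequences are nondecreasing, so one index serves both coordinates. *)
  exists (maxn n k) => //; split => /=.
  - by move: Fn; apply/subsetPset/ndF/leq_maxl.
  - by move: Gk; apply/subsetPset/ndG/leq_maxr.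
move=> n; have [mF Fn] := Foo n; have [mG Gn] := Goo n; split.
  by rewrite -[X in measurable X]setTI; apply: msplit => //; exact: measurableX.
rewrite /lebn_succ /pushforward consK product_measure1E//.
by rewrite lte_mul_pinfty// ge0_fin_numE.
Qed.

HB.instance Definition _ := Measure_isSigmaFinite.Build _ _ _ lebn_succ
  lebn_succ_sigma_finite.

End lebn_succ.

(** Sigma-finiteness is carried in the type because the product measure and Tonelli require it at
    the next dimension. In dimension zero the single point has mass one, matching the base case of
    [iint]. *)
Fixpoint lebn (R : realType) m : {sigma_finite_measure set (Rn R m) -> \bar R} :=
  match m with
  | 0 => @dirac _ (Rn R 0) (fun=> 0) R
  | m'.+1 => lebn_succ (lebn R m')
  end.

Section measurable_slice.
Context d d' d'' (T : measurableType d) (U : measurableType d')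
  (V : measurableType d'').
Variable F : T -> U -> V.
Hypothesis mF : measurable_fun [set: T * U] (fun z => F z.1 z.2).

Lemma measurable_comp2 d0 (S : measurableType d0) (f : S -> T) (g : S -> U) :
  measurable_fun setT f -> measurable_fun setT g ->
  measurable_fun setT (fun s => F (f s) (g s)).
Proof. by move=> mf mg; exact: (measurableT_comp mF (measurable_fun_pair mf mg)). Qed.

Lemma measurable_slice1 x : measurable_fun setT (F x).
Proof.
by apply: measurable_comp2; [exact: measurable_cst|exact: measurable_id].
Qed.

Lemma measurable_slice2 y : measurable_fun setT (F ^~ y).
Proof.
by apply: measurable_comp2; [exact: measurable_id|exact: measurable_cst].
Qed.

End measurable_slice.

Section iint_lebn.
Variable R : realType.
Local Open Scope ereal_scope.

Lemma iintE m (F : Rn R m -> \bar R) : measurable_fun setT F ->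
  (forall x, 0 <= F x) -> iint F = \int[lebn R m]_x F x.
Proof.
elim: m F => [|m ih] F mF F0 /=.
  by rewrite integral_dirac// diracT mul1e.
rewrite [RHS](ge0_integral_pushforward (@measurable_consn R m))//.
rewrite preimage_setT fubini_tonelli1//=; last first.
  exact: (measurableT_comp mF (@measurable_consn R m)).
apply: eq_integral => s _; rewrite /fubini_F ih//.
apply: (measurableT_comp mF).
by apply: measurable_cons_pt; [exact: measurable_cst|exact: measurable_id].
Qed.

(** Tonelli is applied to the positive and negative parts separately. Signed integrands are allowed
    because [iintB] integrates a difference. *)
Lemma measurable_integral2 d d' (T : measurableType d) (U : measurableType d')
    (mu : {sigma_finite_measure set U -> \bar R}) (F : T -> U -> \bar R) :
  measurable_fun [set: T * U] (fun z => F z.1 z.2) ->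
  measurable_fun setT (fun x => \int[mu]_y F x y).
Proof.
move=> mF; under eq_fun do rewrite integralE.
apply: emeasurable_funB.
  apply: (measurable_fun_fubini_tonelli_F (fun z : T * U => (F z.1)^\+ z.2)%E) => //.
  rewrite (_ : (fun z => _) = (fun z => F z.1 z.2)^\+); first exact: measurable_funepos.
  by apply/funext => z; rewrite !funeposE.
apply: (measurable_fun_fubini_tonelli_F (fun z : T * U => (F z.1)^\- z.2)%E) => //.
rewrite (_ : (fun z => _) = (fun z => F z.1 z.2)^\-); first exact: measurable_funeneg.
by apply/funext => z; rewrite !funenegE.
Qed.

Lemma measurable_iint d (T : measurableType d) m (F : T -> Rn R m -> \bar R) :
  measurable_fun [set: T * Rn R m] (fun z => F z.1 z.2) ->
  measurable_fun setT (fun x => iint (F x)).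
Proof.
elim: m d T F => [|m ih] d T F mF /=.
  exact: (measurable_slice2 mF).
apply: measurable_integral2.
apply: (ih _ (T * measurableTypeR R)%type (fun z t => F z.1 (cons_pt z.2 t))).
apply: (measurable_comp2 mF); first exact: (measurableT_comp measurable_fst).
apply: measurable_cons_pt => //.
exact: (measurableT_comp measurable_snd measurable_fst).
Qed.

Lemma iint_ge0 m (F : Rn R m -> \bar R) : (forall x, 0 <= F x) -> 0 <= iint F.
Proof.
elim: m F => [|m ih] F F0 //=.
by apply: integral_ge0 => s _; apply: ih.
Qed.

Lemma tonelli_iint d (T : measurableType d)
    (mu : {sigma_finite_measure set T -> \bar R}) m (F : T -> Rn R m -> \bar R) :
  measurable_fun [set: T * Rn R m] (fun z => F z.1 z.2) -> (forall x y, 0 <= F x y) ->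
  \int[mu]_x iint (F x) = iint (fun y => \int[mu]_x F x y).
Proof.
move=> mF F0; under eq_integral => x _.
  rewrite iintE//; first over.
  exact: measurable_slice1.
rewrite (fubini_tonelli (fun z => F z.1 z.2))// iintE//.
  exact: (measurable_fun_fubini_tonelli_G (fun z => F z.1 z.2)).
by move=> y; apply: integral_ge0.
Qed.

Lemma iintZl m (F : Rn R m -> \bar R) (c : R) : measurable_fun setT F ->
  (forall x, 0 <= F x) -> (0 <= c)%R ->
  iint (fun x => c%:E * F x) = c%:E * iint F.
Proof.
move=> mF F0 c0; rewrite !iintE ?ge0_integralZl ?lee_fin//.
  exact: measurable_funeM.
by move=> x; rewrite mule_ge0// lee_fin.
Qed.

Lemma eq_iint m (F G : Rn R m -> \bar R) : F =1 G -> iint F = iint G.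
Proof. by move=> /funext ->. Qed.

(** Finiteness of the outer integral makes the inner ones finite only for almost every [s], so the
    induction hypothesis yields an almost-everywhere equality of the inner integrals. *)
Lemma iintB m (F1 F2 : Rn R m -> \bar R) :
  measurable_fun setT F1 -> measurable_fun setT F2 ->
  (forall x, 0 <= F1 x) -> (forall x, 0 <= F2 x) ->
  iint F1 < +oo -> iint F2 < +oo ->
  iint (fun x => F1 x - F2 x) = iint F1 - iint F2.
Proof.
elim: m F1 F2 => [|m ih] F1 F2 mF1 mF2 F10 F20 //= F1oo F2oo.
have mcons (F : Rn R m.+1 -> \bar R) : measurable_fun setT F ->
    measurable_fun [set: measurableTypeR R * Rn R m] (fun z => F (cons_pt z.1 z.2)).
  by move=> mF; apply: (measurableT_comp mF); exact: measurable_cons_pt.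
have int (F : Rn R m.+1 -> \bar R) : measurable_fun setT F ->
    (forall x, 0 <= F x) ->
    \int[lebesgue_measure]_s iint (fun t : Rn R m => F (cons_pt s t)) < +oo ->
    (@lebesgue_measure R).-integrable setT
      (fun s => iint (fun t : Rn R m => F (cons_pt s t))).
  move=> mF F0 Foo; apply/integrableP; split.
    apply: (@measurable_iint _ (measurableTypeR R) m (fun s t => F (cons_pt s t))).
    exact: mcons.
  by under eq_integral do rewrite gee0_abs ?iint_ge0//.
have i1 := int _ mF1 F10 F1oo; have i2 := int _ mF2 F20 F2oo.
rewrite -integralB//.
apply: ae_eq_integral => //.
- apply: (@measurable_iint _ (measurableTypeR R) m
    (fun s t => F1 (cons_pt s t) - F2 (cons_pt s t))).
  by apply: emeasurable_funB; exact: mcons.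
- by apply: emeasurable_funB; [have /integrableP[] := i1|have /integrableP[] := i2].
have := integrable_ae measurableT i1.
have := integrable_ae measurableT i2.
apply: filterS2 => s f2 f1 _.
apply: ih => //.
- exact: (@measurable_slice1 _ _ _ (measurableTypeR R) (Rn R m) _
    (fun s t => F1 (cons_pt s t)) (mcons _ mF1)).
- exact: (@measurable_slice1 _ _ _ (measurableTypeR R) (Rn R m) _
    (fun s t => F2 (cons_pt s t)) (mcons _ mF2)).
- by have := f1 I; rewrite ge0_fin_numE// iint_ge0.
- by have := f2 I; rewrite ge0_fin_numE// iint_ge0.
Qed.

End iint_lebn.

(** * Measures given by a density, and image measures *)

Section density.
Context d (T : measurableType d) (R : realType).
Variables (mu : {measure set T -> \bar R}) (h : T -> R).
Hypotheses (mh : measurable_fun setT h) (h0 : forall x, 0 <= h x).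
Local Open Scope ereal_scope.

Definition density (A : set T) := \int[mu]_(x in A) (h x)%:E.

Let density0 : density set0 = 0.
Proof. exact: integral_set0. Qed.

Let density_ge0 A : 0 <= density A.
Proof. by apply: integral_ge0 => x _; rewrite lee_fin. Qed.

Let density_sigma_additive : semi_sigma_additive density.
Proof.
move=> F mF tF mUF; rewrite /density ge0_integral_bigcup//; last 2 first.
- exact/measurable_EFinP/measurable_funTS.
- by move=> x _; rewrite lee_fin.
by apply: is_cvg_ereal_nneg_natsum_cond => n _ _; exact: density_ge0.
Qed.

HB.instance Definition _ := isMeasure.Build _ _ _ density
  density0 density_ge0 density_sigma_additive.

Definition density_measure : {measure set T -> \bar R} := density.

Import HBNNSimple.

(** Linearity settles simple functions; monotone convergence passes to the limit on both sides. *)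
Lemma ge0_integral_density (f : T -> \bar R) : measurable_fun setT f ->
  (forall x, 0 <= f x) -> \int[density_measure]_x f x = \int[mu]_x (f x * (h x)%:E).
Proof.
rewrite /density_measure => mf f0; pose f_ := nnsfun_approx measurableT mf.
have f_cvg x : (EFin \o f_ ^~ x) n @[n --> \oo] --> f x.
  by apply: cvg_nnsfun_approx => // y _; exact: f0.
have f_nd x : {homo (fun n => (f_ n x)%:E) : a b / (a <= b)%N >-> a <= b}.
  by move=> a b ab; rewrite lee_fin; exact/lefP/nd_nnsfun_approx.
transitivity (limn (fun n => \int[density]_x (f_ n x)%:E)).
  rewrite -monotone_convergence//.
  - by apply: eq_integral => x _; apply/esym/cvg_lim => //; exact: f_cvg.
  - by move=> n; exact/measurable_EFinP/measurable_funP.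
  - by move=> n x _; rewrite lee_fin.
transitivity (limn (fun n => \int[mu]_x ((f_ n x)%:E * (h x)%:E))); last first.
  rewrite -monotone_convergence//.
  - apply: eq_integral => x _; apply/cvg_lim => //.
    by apply: cvgeZr => //; exact: f_cvg.
  - move=> n; apply: emeasurable_funM => //; last exact/measurable_EFinP.
    exact/measurable_EFinP/measurable_funP.
  - by move=> n x _; rewrite mule_ge0// lee_fin.
  - by move=> x _ a b ab; rewrite lee_wpmul2r ?lee_fin// -lee_fin f_nd.
congr (limn _); apply/funext => n.
have mpre r : measurable (f_ n @^-1` [set r]) by exact: measurable_sfunP.
transitivity (\sum_(k \in range (f_ n)) k%:E * density (f_ n @^-1` [set k])).
  by rewrite integralT_nnsfun sintegralE.
transitivity (\sum_(k \in range (f_ n))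
    \int[mu]_x ((k * \1_(f_ n @^-1` [set k]) x)%:E * (h x)%:E)).
  apply: eq_fsbigr => k H.
  move: H; rewrite inE => -[t _ <-{k}]; set k := f_ n t.
  under eq_integral do rewrite EFinM -muleA.
  rewrite ge0_integralZl//.
  - congr (_ * _); rewrite /density integral_mkcond; apply: eq_integral => x _.
    rewrite patchE indicE; case: (x \in _); by rewrite ?mul1e ?mul0e.
  - apply: emeasurable_funM; last exact/measurable_EFinP.
    exact/measurable_EFinP.
  - by move=> x _; rewrite mule_ge0 ?lee_fin.
  - by rewrite lee_fin.
rewrite -ge0_integral_fsum//.
- apply: eq_integral => x _.
  rewrite -ge0_mule_fsuml; last by move=> i; rewrite nnfun_muleindic_ge0.
  by rewrite fsumEFin// -fimfunE.
- move=> r; apply: emeasurable_funM; last exact/measurable_EFinP.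
  exact/measurable_EFinP/measurable_funM.
- move=> r x _; rewrite mule_ge0 ?lee_fin//.
  by rewrite -lee_fin EFinM nnfun_muleindic_ge0.
Qed.

End density.

Definition image_measure d d' (T : measurableType d) (T' : measurableType d')
    (R : realType) (mu : {measure set T -> \bar R}) (f : T -> T')
    (mf : measurable_fun setT f) : {measure set T' -> \bar R} :=
  measure_function_pushforward__canonical__measure_function_Measure mu mf.

Lemma ge0_integral_image d d' (T : measurableType d) (T' : measurableType d')
    (R : realType) (mu : {measure set T -> \bar R}) (f : T -> T')
    (mf : measurable_fun setT f) (g : T' -> \bar R) :
  measurable_fun setT g -> (forall y, 0 <= g y)%E ->
  (\int[image_measure mu mf]_y g y = \int[mu]_x g (f x))%E.
Proof. by move=> mg g0; rewrite ge0_integral_pushforward. Qed.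

(** * Real roots as measurable functions of the coefficients *)

Section polyf.
Variable R : realType.

Definition polyf m (a : 'I_m -> R) : {poly R} := \sum_(i < m) a i *: 'X^i.

Definition coefs m (q : {poly R}) : 'I_m -> R := fun i => q`_i.
Arguments coefs m q i : clear implicits.

Lemma coef_polyf m (a : 'I_m -> R) (i : 'I_m) : (polyf a)`_i = a i.
Proof.
rewrite coef_sum (bigD1 i)//= coefZ coefXn eqxx mulr1 big1 ?addr0// => j ji.
by rewrite coefZ coefXn eq_sym (negbTE (_ : _ != _ :> nat)) ?mulr0.
Qed.

Lemma size_polyf m (a : 'I_m -> R) : (size (polyf a) <= m)%N.
Proof.
apply: (leq_trans (size_sum _ _ _)); apply/bigmax_leqP => i _.
by rewrite (leq_trans (size_scale_leq _ _))// size_polyXn.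
Qed.

Lemma coefsK m (a : 'I_m -> R) : coefs m (polyf a) = a.
Proof. by apply/funext => i; rewrite /coefs coef_polyf. Qed.

Lemma polyfK m (q : {poly R}) : (size q <= m)%N -> polyf (coefs m q) = q.
Proof.
move=> qm; apply/polyP => i; have [im|mi] := ltnP i m.
  exact: (coef_polyf _ (Ordinal im)).
by rewrite !nth_default// (leq_trans _ mi)// size_polyf.
Qed.

Lemma horner_polyf m (a : 'I_m -> R) x :
  (polyf a).[x] = \sum_(i < m) a i * x ^+ i.
Proof. by rewrite horner_sum; apply: eq_bigr => i _; rewrite hornerZ hornerXn. Qed.

Lemma polyf_eq0 m (a : 'I_m -> R) : (polyf a == 0) = [forall i, a i == 0].
Proof.
apply/eqP/forallP => [a0 i|a0]; first by rewrite -coef_polyf a0 coef0.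
by rewrite /polyf big1// => i _; rewrite (eqP (a0 i)) scale0r.
Qed.

Lemma polyf_cons m (y : R) (a : 'I_m -> R) :
  polyf (cons_pt y a) = y%:P + 'X * polyf a.
Proof.
rewrite /polyf big_ord_recl cons_pt0 alg_polyC; congr (_ + _).
rewrite big_distrr; apply: eq_bigr => i _/=; rewrite cons_ptS.
by rewrite -scalerAr -exprS.
Qed.

Lemma mem_rootsR (q : {poly R}) x : (x \in rootsR q) = (q != 0) && root q x.
Proof.
have [->|q0] := eqVneq q 0; first by rewrite rootsR0.
by have /(_ x)/= <- := roots_on_rootsR q0.
Qed.

Lemma rootsR_sorted (q : {poly R}) : sorted <%R (rootsR q).
Proof. exact: sorted_roots. Qed.

Lemma rootsR_uniq (q : {poly R}) : uniq (rootsR q).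
Proof. exact: (sorted_uniq lt_trans (@ltxx _ _) (rootsR_sorted q)). Qed.

Lemma size_rootsR m (q : {poly R}) : (size q <= m)%N -> (size (rootsR q) <= m)%N.
Proof.
have [->|q0] := eqVneq q 0; first by rewrite rootsR0.
apply: leq_trans; apply/ltnW/max_poly_roots => //; last exact: rootsR_uniq.
by apply/allP => x; rewrite mem_rootsR => /andP[].
Qed.

End polyf.

Arguments coefs {R} m q i.

Section measurable_root.
Variables (R : realType) (m : nat).

Lemma measurable_horner_polyf d (T : measurableType d) (a : T -> Rn R m)
    (x : T -> R) : measurable_fun setT a -> measurable_fun setT x ->
  measurable_fun setT (fun t => (polyf (a t)).[x t]).
Proof.
move=> ma mx; under eq_fun do rewrite horner_polyf.
apply: measurable_sum => i; apply: measurable_funM; last exact: measurable_funX.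
exact: (measurableT_comp (measurable_coord i) ma).
Qed.

(** Turns the existence of a root into a countable condition. Continuity gives small values at
    nearby rationals; conversely [|q|] attains its minimum on the compact interval, and this minimum
    must be zero. *)
Lemma has_root_itvP (q : {poly R}) (p r : R) : p < r ->
  (exists2 x, p <= x <= r & root q x) <->
  (forall n : nat, exists2 s : rat, p <= ratr s <= r &
     `|q.[ratr s]| < n.+1%:R^-1).
Proof.
move=> pr; split.
  move=> [x /andP[px xr] /rootP qx0] n.
  have /cvgrPdist_lt/(_ n.+1%:R^-1) := @continuous_horner _ q x.
  rewrite invr_gt0 ltr0n => /(_ isT)/nbhs_ballP[e /= e0 He].
  (* The part of []p, r[] within [e] of [x]: nonempty even when [x] is an endpoint, because
     [p < r]. *)
  have [|s /[!in_itv]/= /andP[]] := @rat_in_itvoo _ (Num.max p (x - e)) (Num.min r (x + e)).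
    by rewrite gt_max !lt_min pr/=; apply/andP; split; lra.
  rewrite gt_max lt_min => /andP[ps xes] /andP[sr sxe].
  exists s; first by rewrite !ltW.
  have := He (ratr s); rewrite qx0 sub0r normrN; apply.
  by rewrite /ball/= ltr_norml; apply/andP; split; lra.
move=> H; have [|c cpr cmin] := @EVT_min R (fun x => `|q.[x]|) p r (ltW pr).
  apply: continuous_subspaceT => x.
  by apply: continuous_comp; [exact: continuous_horner|exact: norm_continuous].
exists c; first by move: cpr; rewrite in_itv.
rewrite rootE -normr_le0 leNgt; apply/negP => c0.
have [n] := ltr_add_invr c0; rewrite add0r => nc.
have [s sI sn] := H n.
have := cmin (ratr s); rewrite in_itv/= => /(_ sI).
by rewrite leNgt (lt_trans sn nc).
Qed.

Lemma measurable_has_root (p r : R) : p < r ->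
  measurable [set a : Rn R m | exists2 x, p <= x <= r & root (polyf a) x].
Proof.
move=> pr.
rewrite [X in measurable X](_ : _ =
    \bigcap_n \bigcup_(s in [set s : rat | p <= ratr s <= r])
    [set a : Rn R m | `|(polyf a).[ratr s]| < n.+1%:R^-1]); last first.
  apply/seteqP; split=> a /=.
    by move/(has_root_itvP _ pr) => H n _; have [s ? ?] := H n; exists s.
  by move=> H; apply/(has_root_itvP _ pr) => n; have [s ? ?] := H n I; exists s.
apply: bigcapT_measurable => n.
rewrite bigcup_mkcond; apply: countable_bigcupT_measurable => // s.
case: ifPn => // _.
rewrite -[X in measurable X]setTI.
have mf : measurable_fun setT (fun a : Rn R m => `|(polyf a).[ratr s]|).
  apply: measurableT_comp => //.
  exact: measurable_horner_polyf.
rewrite (_ : [set a | _] = (fun a : Rn R m => `|(polyf a).[ratr s]|) @^-1`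
   [set` `]-oo, n.+1%:R^-1[]); last by apply/seteqP; split=> a /=; rewrite in_itv.
exact: mf.
Qed.

(* [+oo] when there are at most [j] roots, in particular for the zero polynomial. *)
Definition nth_root (j : nat) (a : Rn R m) : \bar R :=
  nth +oo%E (map EFin (rootsR (polyf a))) j.

Lemma nth_rootE j a : nth_root j a =
  if (j < size (rootsR (polyf a)))%N then ((rootsR (polyf a))`_j)%:E else +oo%E.
Proof.
rewrite /nth_root; case: ltnP => jr; first by rewrite (nth_map 0).
by rewrite nth_default// size_map.
Qed.

Let rat_between (x y : R) : x < y -> exists q : rat, x < ratr q < y.
Proof. by move=> /rat_in_itvoo[q]; rewrite in_itv; exists q. Qed.

Lemma nth_root0_lt a (y : R) : (nth_root 0 a < y%:E)%E <->
  polyf a != 0 /\ exists pr : rat * rat, [/\ pr.1 < pr.2, ratr pr.2 < y &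
    exists2 x, ratr pr.1 <= x <= ratr pr.2 & root (polyf a) x].
Proof.
rewrite nth_rootE; set s := rootsR _; split.
  case: ifPn => // s0; rewrite lte_fin => xy.
  have := mem_nth 0 s0; rewrite mem_rootsR => /andP[a0 rx]; split => //.
  have [q /andP[xq qy]] := rat_between xy.
  have /rat_between[p /andP[_ px]] : s`_0 - 1 < s`_0 by lra.
  exists (p, q); split => //=; first by rewrite -(ltr_rat R) (lt_trans px).
  by exists s`_0 => //; rewrite !ltW.
move=> [a0 [[p q] /= [pq qy [x /andP[px xq] rx]]]].
have xs : x \in s by rewrite mem_rootsR a0.
have s0 : (0 < size s)%N.
  by rewrite (leq_ltn_trans (leq0n _) (_ : (index x s < _)%N)) ?index_mem.
rewrite s0 lte_fin (le_lt_trans _ (le_lt_trans xq qy))// -(nth_index 0 xs).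
by rewrite (lt_sorted_leq_nth 0 (rootsR_sorted _))// inE ?index_mem.
Qed.

(** The roots are sorted, so a root above a rational that exceeds the [j]-th root has index greater
    than [j]. Sublevel sets of successive roots are thus countable unions of measurable sets, by
    induction on [j]. *)
Lemma nth_rootS_lt j a (y : R) : (nth_root j.+1 a < y%:E)%E <->
  polyf a != 0 /\ exists pr : rat * rat, [/\ pr.1 < pr.2, ratr pr.2 < y,
    (nth_root j a < (ratr pr.1)%:E)%E &
    exists2 x, ratr pr.1 <= x <= ratr pr.2 & root (polyf a) x].
Proof.
rewrite !nth_rootE; set s := rootsR _; split.
  case: ifPn => // s0; rewrite lte_fin => xy.
  have := mem_nth 0 s0; rewrite mem_rootsR => /andP[a0 rx]; split => //.
  have [q /andP[xq qy]] := rat_between xy.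
  have jS : s`_j < s`_j.+1.
    by rewrite (lt_sorted_ltn_nth 0 (rootsR_sorted _))// inE// ltnW.
  have [p /andP[jp px]] := rat_between jS.
  exists (p, q); split => //=; first by rewrite -(ltr_rat R) (lt_trans px).
    by rewrite ltnW// lte_fin.
  by exists s`_j.+1 => //; rewrite !ltW.
move=> [a0 [[p q] /= [pq qy]]]; case: ifPn => // js; rewrite lte_fin => jp.
move=> [x /andP[px xq] rx].
have xs : x \in s by rewrite mem_rootsR a0.
have jx : (j < index x s)%N.
  have := @lt_sorted_ltn_nth _ _ 0 _ (rootsR_sorted (polyf a)) j (index x s).
  rewrite !inE index_mem => /(_ js xs) <-.
  by rewrite nth_index// (lt_le_trans jp).
have xs' : (index x s < size s)%N by rewrite index_mem.
rewrite (leq_ltn_trans jx)// lte_fin (le_lt_trans _ (le_lt_trans xq qy))//.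
rewrite -(nth_index 0 xs) (lt_sorted_leq_nth 0 (rootsR_sorted _))// inE.
exact: leq_ltn_trans jx _.
Qed.

Lemma measurable_polyf_neq0 : measurable [set a : Rn R m | polyf a != 0].
Proof.
rewrite [X in measurable X](_ : _ = ~` \bigcap_(i in [set: 'I_m])
    ((fun a : Rn R m => a i) @^-1` [set 0])); last first.
  apply/seteqP; split=> a /=; rewrite polyf_eq0.
    move=> /forallPn[i ai] H; move: ai; have -> := H i I; by rewrite eqxx.
  move=> H; apply/negP => /forallP ai; apply: H => i _ /=; exact/eqP.
apply: measurableC; apply: fin_bigcap_measurable => // i _.
rewrite -[X in measurable X]setTI; apply: measurable_coord => //.
Qed.

Lemma emeasurable_fun_lt d (T : measurableType d) (f : T -> \bar R) :
  (forall y : R, measurable [set t | (f t < y%:E)%E]) -> measurable_fun setT f.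
Proof.
move=> H; apply: (measurability (@ErealGenInftyO.G R)).
  exact: ErealGenInftyO.measurableE.
move=> _ [_ [y ->] <-]; rewrite setTI.
by rewrite (_ : _ @^-1` _ = [set t | (f t < y%:E)%E])//; apply/seteqP; split=> t /=;
  rewrite in_itv.
Qed.

Lemma measurable_lte_cst d (T : measurableType d) (f : T -> \bar R) (y : \bar R) :
  measurable_fun setT f -> measurable [set t | (f t < y)%E].
Proof.
move=> mf; rewrite -[X in measurable X]setTI.
rewrite (_ : [set t | _] = f @^-1` [set` `]-oo, y[]).
  by apply: mf => //; exact: emeasurable_itv.
by apply/seteqP; split=> t /=; rewrite in_itv.
Qed.

Lemma measurable_nth_root j : measurable_fun setT (nth_root j).
Proof.
elim: j => [|j ih]; apply: emeasurable_fun_lt => y.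
  rewrite (_ : [set t | _] = [set a : Rn R m | polyf a != 0] `&`
      \bigcup_(pr in [set pr : rat * rat | (pr.1 < pr.2) && (ratr pr.2 < y)])
      [set a : Rn R m | exists2 x, ratr pr.1 <= x <= ratr pr.2 & root (polyf a) x]);
      last first.
    apply/seteqP; split=> a /=.
      by move=> /nth_root0_lt[a0 [pr [p1 p2 p3]]]; split => //;
        exists pr => //=; apply/andP.
    move=> [a0 [pr /= /andP[p1 p2] p3]]; apply/nth_root0_lt; split => //.
    by exists pr.
  apply: measurableI; first exact: measurable_polyf_neq0.
  rewrite bigcup_mkcond; apply: countable_bigcupT_measurable => // -[p q].
  case: ifPn => //; rewrite inE/= => /andP[pq qy].
  by apply: measurable_has_root; rewrite ltr_rat.
rewrite (_ : [set t | _] = [set a : Rn R m | polyf a != 0] `&`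
    \bigcup_(pr in [set pr : rat * rat | (pr.1 < pr.2) && (ratr pr.2 < y)])
    ([set a : Rn R m | (nth_root j a < (ratr pr.1)%:E)%E] `&`
    [set a : Rn R m | exists2 x, ratr pr.1 <= x <= ratr pr.2 & root (polyf a) x]));
    last first.
  apply/seteqP; split=> a /=.
    by move=> /nth_rootS_lt[a0 [pr [p1 p2 p3 p4]]]; split => //;
        exists pr => //=; apply/andP.
  move=> [a0 [pr /= /andP[p1 p2] [p3 p4]]]; apply/nth_rootS_lt; split => //.
  by exists pr.
apply: measurableI; first exact: measurable_polyf_neq0.
rewrite bigcup_mkcond; apply: countable_bigcupT_measurable => // -[p q].
case: ifPn => //; rewrite inE/= => /andP[pq qy].
apply: measurableI; first exact: measurable_lte_cst.
by apply: measurable_has_root; rewrite ltr_rat.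
Qed.

Local Open Scope ereal_scope.

(** A fixed number of terms replaces a list whose length depends on [a], so measurability can be
    checked term by term. *)
Lemma sum_rootsRE (a : Rn R m) (H : R -> \bar R) :
  \sum_(x <- rootsR (polyf a)) H x =
  \sum_(j < m) (if nth_root j a < +oo then H (fine (nth_root j a)) else 0).
Proof.
rewrite (big_nth 0%R) big_mkord.
have sm := size_rootsR (size_polyf a).
rewrite (big_ord_widen _ (fun i => H (rootsR (polyf a))`_i) sm) big_mkcond/=.
by apply: eq_bigr => i _; rewrite nth_rootE; case: ifPn; rewrite ?ltry ?ltxx.
Qed.

Lemma measurable_sum_rootsR d (T : measurableType d) (a : T -> Rn R m)
    (H : T -> measurableTypeR R -> \bar R) : measurable_fun setT a ->
  measurable_fun [set: T * measurableTypeR R] (fun z => H z.1 z.2) ->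
  measurable_fun setT (fun t => \sum_(x <- rootsR (polyf (a t))) H t x).
Proof.
move=> ma mH; under eq_fun do rewrite sum_rootsRE.
apply: emeasurable_sum => j.
have mr : measurable_fun setT (fun t => nth_root j (a t)).
  by apply: measurableT_comp => //; exact: measurable_nth_root.
apply: measurable_fun_ifT => //.
- exact: measurable_fun_lte.
- by apply: (measurable_comp2 mH) => //; exact: measurableT_comp.
Qed.

End measurable_root.

(** * The area formula for a polynomial of one variable *)

Section area_formula.
Variable R : realType.
Local Notation lambda := (@lebesgue_measure R).

Lemma measurable_horner (q : {poly R}) D :
  measurable_fun (D : set (measurableTypeR R)) (horner q).
Proof.
apply: measurable_funTS; apply: continuous_measurable_fun.
exact: continuous_horner.
Qed.

Lemma FTC_horner (q : {poly R}) c d : (c < d)%R ->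
  (\int[lambda]_(x in `]c, d[) (q^`().[x])%:E = (q.[d] - q.[c])%:E)%E.
Proof.
have mq D : measurable_fun (D : set (measurableTypeR R)) (fun x => (q^`().[x])%:E).
  by apply/measurable_EFinP; exact: measurable_horner.
move=> cd; rewrite integral_itv_bndo_bndc; last exact: mq.
rewrite integral_itv_obnd_cbnd; last exact: mq.
rewrite (continuous_FTC2 (F := horner q) cd)//.
- by apply: continuous_subspaceT => x; exact: continuous_horner.
- split => [x _||].
  + exact: derivable_horner.
  + by apply: cvg_at_right_filter; exact: continuous_horner.
  + by apply: cvg_at_left_filter; exact: continuous_horner.
- by move=> x _; rewrite derivE.
Qed.

(** Half-open intervals tile without overlap when an interval is cut. The sign of the derivative is
    assumed only in the interior, since the cuts are made at critical points. *)
Lemma horner_incr (q : {poly R}) c d : (c < d)%R ->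
  (forall x, x \in `]c, d[ -> 0 < q^`().[x])%R ->
  (forall x y, x \in `]c, d] -> y \in `]c, d] -> q.[x] = q.[y] -> x = y) /\
  (forall v, (exists2 x, x \in `]c, d] & q.[x] = v) <-> (q.[c] < v <= q.[d])%R).
Proof.
move=> cd q'0; split.
  move=> x y xI yI; apply: (derp_inj q'0); exact: subset_itv_oc_cc.
move=> v; split.
  move=> [x xI <-]; rewrite (derpr q'0)//= (derplW q'0)//; exact: subset_itv_oc_cc.
move=> /andP[cv vd].
have [|x] := @poly_ivt _ (q - v%:P) c d (ltW cd).
  by rewrite !hornerE subr_le0 subr_ge0 ltW.
rewrite rootE !hornerE subr_eq0 => /andP[cx xd] /eqP qx.
exists x => //; rewrite in_itv/= xd andbT lt_neqAle cx andbT.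
by apply/eqP => xc; move: cv; rewrite xc qx ltxx.
Qed.

Lemma sum_indic_root (q : {poly R}) (A : set R) : q != 0%R ->
  (forall x y, A x -> A y -> root q x -> root q y -> x = y) ->
  (\sum_(x <- rootsR q) (\1_A x)%:E =
   (if `[< exists2 x, A x & root q x >] then 1 else 0) :> \bar R)%E.
Proof.
move=> q0 inj; case: asboolP => [[x Ax rx]|nA].
  rewrite (bigD1_seq x)/= ?rootsR_uniq ?mem_rootsR ?q0//.
  rewrite indicE mem_set// big1_seq ?adde0// => y /andP[yx].
  rewrite mem_rootsR q0/= => ry; rewrite indicE memNset// => Ay.
  by move/eqP : yx; apply; exact: inj.
rewrite big1_seq// => y /andP[_]; rewrite mem_rootsR => /andP[_ ry].
by rewrite indicE memNset// => Ay; apply: nA; exists y.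
Qed.

(** [rootsR] is empty on the zero polynomial, a case that a nonconstant [q] excludes for every [y]
    at once. *)
Lemma deriv_neq0_translate (q : {poly R}) (y : R) :
  q^`()%R != 0%R -> (y%:P + q)%R != 0%R.
Proof.
by apply: contra => /eqP/(congr1 (@deriv _)); rewrite derivD derivC add0r deriv0 => ->.
Qed.

(** Both sides are the length of the image of []c, d]] under [- g], which is injective there: each
    [y] has at most one root in the interval, and the fundamental theorem of calculus gives the
    length. *)
Lemma area_monotone (g : {poly R}) c d : (c < d)%R ->
  (forall x, x \in `]c, d[ -> g^`().[x] != 0)%R ->
  (\int[lambda]_y \sum_(x <- rootsR (y%:P + g)%R) (\1_(`]c, d]%classic) x)%:E =
  \int[lambda]_(x in `]c, d]) (`|g^`().[x]|)%:E)%E.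
Proof.
move=> cd g'0.
set m := ((c + d) / 2)%R.
have mI : m \in `]c, d[ by rewrite in_itv/=; apply/andP; split; rewrite /m; lra.
have g'N0 : (g^`() != 0)%R.
  by have := g'0 _ mI; apply: contra => /eqP ->; rewrite horner0.
(* Without zeros in the interval, the derivative keeps the sign it has at the midpoint [m]. *)
have sgn x y : x \in `]c, d[ -> y \in `]c, d[ -> Num.sg g^`().[x] = Num.sg g^`().[y].
  move=> xI yI; apply: (@polyrN0_itv R `]c, d[ g^`()) => //.
have rE y x : root (y%:P + g) x = (g.[x] == - y)%R.
  by rewrite rootE !hornerE addrC addr_eq0.
rewrite -integral_itv_bndo_bndc; last first.
  apply/measurable_EFinP; apply: measurableT_comp => //.
  exact: measurable_horner.
have [gm|gm] : (0 < g^`().[m] \/ g^`().[m] < 0)%R.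
  by apply/orP; rewrite orbC -neq_lt g'0.
- have g'p x : x \in `]c, d[ -> (0 < g^`().[x])%R.
    by move=> xI; rewrite -sgr_cp0 (sgn _ m)// sgr_cp0.
  have [inj im] := horner_incr cd g'p.
  (* The roots solve [g x = - y]; for increasing [g] the reflection of the image is closed on the
     left. *)
  transitivity (\int[lambda]_y (\1_(`[(- g.[d])%R, (- g.[c])%R[%classic) y)%:E)%E.
    apply: eq_integral => y _; rewrite sum_indic_root ?deriv_neq0_translate//; last first.
      move=> x z xA zA; rewrite !rE => /eqP gx /eqP gz.
      by apply: inj; rewrite ?gx ?gz.
    rewrite indicE; case: asboolP => [[x xA]|nx].
      rewrite rE => /eqP gx; rewrite mem_set//= in_itv/=.
      have /im/andP[ly yu] : exists2 x, x \in `]c, d] & g.[x] = (- y)%R by exists x.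
      by rewrite lerNl yu ltrNr ly.
    rewrite memNset//= in_itv/= => /andP[yu ly]; apply: nx.
    have /im[x xA gx] : (g.[c] < - y <= g.[d])%R by rewrite ltrNr ly lerNl yu.
    by exists x => //; rewrite rE gx.
  rewrite integral_indic//= setIT lebesgue_measure_itv/= lte_fin ltrN2.
  rewrite (derpr g'p) ?bound_itvE// -EFinD opprK addrC -FTC_horner//.
  by apply: eq_integral => x; rewrite inE/= => xI; rewrite gtr0_norm// g'p.
- have g'p x : x \in `]c, d[ -> (0 < (- g)^`().[x])%R.
    move=> xI; rewrite derivN hornerN oppr_gt0.
    by rewrite -sgr_cp0 (sgn _ m)// sgr_cp0.
  have [inj im] := horner_incr cd g'p.
  transitivity (\int[lambda]_y (\1_(`](- g).[c], (- g).[d]]%classic) y)%:E)%E.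
    apply: eq_integral => y _; rewrite sum_indic_root ?deriv_neq0_translate//; last first.
      move=> x z xA zA; rewrite !rE => /eqP gx /eqP gz.
      by apply: inj; rewrite ?hornerN ?gx ?gz.
    rewrite indicE; case: asboolP => [[x xA]|nx].
      rewrite rE => /eqP gx; rewrite mem_set//= in_itv/=.
      by apply/im; exists x => //; rewrite hornerN gx opprK.
    rewrite memNset//= in_itv/= => /im[x xA gx]; apply: nx.
    by exists x => //; rewrite rE -gx hornerN opprK.
  rewrite integral_indic//= setIT lebesgue_measure_itv/= lte_fin.
  rewrite (derpr g'p) ?bound_itvE// -EFinD -FTC_horner//.
  apply: eq_integral => x; rewrite inE/= => xI.
  by rewrite derivN hornerN ltr0_norm// -oppr_gt0 -hornerN -derivN g'p.
Qed.

Section root_measure.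
Variable g : {poly R}.

(** The successor covers [g = 0], where [y%:P] alone can have size one. *)
Let N := (size g).+1.
Let a (y : measurableTypeR R) : Rn R N := coefs N (y%:P + g)%R.

Let polyf_a y : polyf (a y) = (y%:P + g)%R.
Proof.
rewrite polyfK// (leq_trans (size_polyD _ _))// geq_max leqnSn andbT.
by rewrite (leq_trans (size_polyC_leq1 _)).
Qed.

Let measurable_a : measurable_fun setT a.
Proof.
apply: measurable_RnP => i; rewrite /a /coefs.
under eq_fun do rewrite coefD coefC.
apply: measurable_funD; last exact: measurable_cst.
by case: (nat_of_ord i == 0)%N; [exact: measurable_id|exact: measurable_cst].
Qed.

Let r j (y : measurableTypeR R) := nth_root j (a y).

Let measurable_r j : measurable_fun setT (r j).
Proof. by apply: measurableT_comp => //; exact: measurable_nth_root. Qed.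

(** Where there are at most [j] roots, [fine] sends [+oo] to 0 and the image measure would gain
    spurious mass there; this density discards those [y]. *)
Let h j (y : measurableTypeR R) : R := if (r j y < +oo)%E then 1 else 0.

Let measurable_h j : measurable_fun setT (h j).
Proof. by apply: measurable_fun_ifT => //; exact: measurable_fun_lte. Qed.

Let h_ge0 j y : (0 <= h j y)%R.
Proof. by rewrite /h; case: ifP. Qed.

Let measurable_fine_r j :
  measurable_fun setT (fine \o r j : measurableTypeR R -> measurableTypeR R).
Proof. exact: measurableT_comp. Qed.

(* The measure [A |-> \int_y #{x in A | y + g(x) = 0}], realised as a sum over [j]
   of images of Lebesgue measure under the [j]-th root. *)
Definition root_measure : {measure set (measurableTypeR R) -> \bar R} :=
  msum (fun j => image_measure (density_measure lambda (measurable_h j) (h_ge0 j))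
                  (measurable_fine_r j)) N.

Lemma integral_root_measure (phi : measurableTypeR R -> \bar R) : measurable_fun setT phi ->
  (forall x, 0 <= phi x)%E ->
  (\int[root_measure]_x phi x =
   \int[lambda]_y \sum_(x <- rootsR (y%:P + g)%R) phi x)%E.
Proof.
move=> mphi phi0; rewrite ge0_integral_measure_sum//.
under eq_bigr => j _.
  rewrite ge0_integral_image// ge0_integral_density//; last first.
    exact: (measurableT_comp mphi (measurable_fine_r j)).
  over.
rewrite -ge0_integral_sum//.
- apply: eq_integral => y _; rewrite -polyf_a sum_rootsRE.
  by apply: eq_bigr => j _; rewrite /h /r/=; case: ifP; rewrite ?mule1 ?mule0.
- move=> j; apply: emeasurable_funM; first exact: (measurableT_comp mphi (measurable_fine_r j)).
  exact/measurable_EFinP.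
- by move=> j y _; rewrite mule_ge0// lee_fin.
Qed.

Let abs_deriv_ge0 x : (0 <= `|g^`().[x]|)%R. Proof. exact: normr_ge0. Qed.

Let measurable_abs_deriv :
  measurable_fun setT (fun x : measurableTypeR R => `|g^`().[x]|%R).
Proof. by apply: measurableT_comp => //; exact: measurable_horner. Qed.

Let nu := density_measure lambda measurable_abs_deriv abs_deriv_ge0.

Lemma root_measure_itv (c d : R) : (g^`() != 0)%R -> (c <= d)%R ->
  root_measure `]c, d]%classic = nu `]c, d]%classic.
Proof.
(* Cut the interval at a critical point of [g] until none is left inside. *)
move=> g'0.
have [n] := ubnP (size [seq x <- rootsR g^`() | c < x < d]%R).
elim: n c d => // n ih c d.
rewrite ltnS le_eqVlt => sn /predU1P[->|cd].
  by rewrite set_itvoc0 !measure0.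
have [/hasP[z]|/hasPn H] := boolP (has (fun x => c < x < d)%R (rootsR g^`())).
  move=> zr /andP[cz zd].
  have -> : `]c, d]%classic = `]c, z] `|` `]z, d].
    by rewrite -itv_bndbnd_setU// bnd_simp ltW.
  have cap : `]c, z] `&` `]z, d] = set0.
    by apply/seteqP; split=> x //=; rewrite !in_itv/= => -[/andP[_ xz] /andP[zx _]];
      move: (lt_le_trans zx xz); rewrite ltxx.
  rewrite !measureU//.
  (* [z] is interior to neither half, so each half has strictly fewer interior critical points than
     the whole. *)
  have szlt (P : pred R) : (forall x, P x -> c < x < d)%R -> ~~ P z ->
     (size [seq x <- rootsR g^`()%R | P x] < n)%N.
    move=> Psub Pz; apply: leq_trans sn.
    rewrite -[X in (X <= _)%N]/(size (z :: [seq x <- rootsR g^`() | P x])).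
    apply: uniq_leq_size.
      by rewrite /= mem_filter (negbTE Pz)/= filter_uniq// rootsR_uniq.
    move=> x; rewrite inE !mem_filter => /predU1P[->|/andP[/Psub -> ->]//].
    by rewrite cz zd zr.
  congr (_ + _)%E; apply: ih; rewrite ?ltW//; apply: szlt.
  - by move=> x /andP[-> /lt_trans->].
  - by rewrite ltxx andbF.
  - by move=> x /andP[/(lt_trans cz)-> ->].
  - by rewrite ltxx.
have := @area_monotone g c d cd; rewrite /nu/= /density => <-; last first.
  move=> x; rewrite in_itv/= => xI; apply/negP => rx.
  by have := H x; rewrite mem_rootsR g'0 rootE rx => /(_ isT); rewrite xI.
rewrite -integral_root_measure//; last first.
  exact/measurable_EFinP.
by rewrite integral_indic// setIT.
Qed.

(** Both sides integrate [phi] against a measure, [root_measure] or [nu]. These agree on half-open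
    intervals, which are stable under intersection and generate the Borel sets, and are finite on
    bounded ones. *)
Lemma area_formula (phi : measurableTypeR R -> \bar R) : measurable_fun setT phi ->
  (forall x, 0 <= phi x)%E ->
  (\int[lambda]_y \sum_(x <- rootsR (y%:P + g)%R) phi x =
   \int[lambda]_x (phi x * (`|g^`().[x]|)%:E))%E.
Proof.
move=> mphi phi0; have [g'0|g'0] := eqVneq g^`()%R 0%R.
  (* For constant [g] the list of roots is empty for every [y], including the one that gives the
     zero polynomial, and the right side vanishes with the derivative. *)
  have gC : g = (g`_0)%:P.
    apply/polyP => -[|i]; rewrite coefC//=.
    have /eqP := congr1 (fun q : {poly R} => q`_i) g'0.
    by rewrite coef_deriv coef0 mulrn_eq0/= => /eqP.
  rewrite !integral0_eq//.
    by move=> x _; rewrite g'0 horner0 normr0 mule0.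
  by move=> y _; rewrite gC -polyCD rootsRC big_nil.
rewrite -integral_root_measure//.
rewrite -(ge0_integral_density lambda measurable_abs_deriv abs_deriv_ge0)//.
apply: eq_measure_integral => A mA _.
have agree c d : root_measure `]c, d]%classic = nu `]c, d]%classic.
  have [cd|/ltW dc] := leP c d; first exact: root_measure_itv.
  by rewrite set_itv_ge ?measure0// bnd_simp -leNgt.
refine (@measure_unique _ R (measurableTypeR R) (@ocitv R)
  (fun n => `](- n%:R)%R, n%:R%R]%classic) erefl (@ocitvI R) _ _ root_measure nu _ _ A mA).
- by move=> n; exists (- n%:R, n%:R).
- by rewrite -(bigcup_itvT false false).
- by move=> _ [[c d] _ <-]; exact: agree.
(* Finiteness on []-n, n]]: the derivative is continuous, hence integrable on the compact
   interval. *)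
- move=> n; rewrite agree.
  apply: (@le_lt_trans _ _ (nu `[(- n%:R)%R, n%:R%R]%classic)).
    by apply: le_measure; rewrite ?inE//; exact: subset_itv_oc_cc.
  have /integrableP[_] : lambda.-integrable `[(- n%:R)%R, n%:R%R]
      (EFin \o (fun x => `|g^`().[x]|)).
    apply: continuous_compact_integrable; first exact: segment_compact.
    apply: continuous_subspaceT => x.
    by apply: continuous_comp; [exact: continuous_horner|exact: norm_continuous].
  by under eq_integral do rewrite /= normr_id.
Qed.

End root_measure.

End area_formula.

(** * Linear triangular substitutions *)

Section triangular.
Variable R : realType.
Local Notation lambda := (@lebesgue_measure R).
Local Notation RR := (measurableTypeR R).

(** The area formula for [g = - (c x + s)]: [y + g] has the single root [(y - s) / c], and the
    derivative has absolute value [c]. *)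
Lemma affine_subst (c s : R) (phi : RR -> \bar R) : 0 < c ->
  measurable_fun setT phi -> (forall x, 0 <= phi x)%E ->
  (\int[lambda]_y phi y = c%:E * \int[lambda]_x phi (c * x + s)%R)%E.
Proof.
move=> c0 mphi phi0.
have mphic : measurable_fun (setT : set RR) (fun x => phi (c * x + s)).
  apply: (measurableT_comp mphi); apply: measurable_funD; last exact: measurable_cst.
  by apply: measurable_funM; [exact: measurable_cst|exact: measurable_id].
rewrite -ge0_integralZl ?lee_fin ?ltW//.
pose g : {poly R} := - (c *: 'X + s%:P).
have gE x : g.[x] = - (c * x + s) by rewrite !hornerE.
have g'E x : g^`().[x] = - c.
  by rewrite derivN derivD derivZ derivX derivC addr0 !hornerE.
transitivity (\int[lambda]_y \sum_(x <- rootsR (y%:P + g)%R) phi (c * x + s)%R)%E.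
  apply: eq_integral => y _.
  have rE x : root (y%:P + g) x = (x == (y - s) / c).
    rewrite rootE hornerD hornerC gE subr_eq0 -subr_eq eq_sym.
    by rewrite -(can2_eq (mulfK (lt0r_neq0 c0)) (mulfVK (lt0r_neq0 c0))) mulrC.
  have q0 : y%:P + g != 0.
    apply: deriv_neq0_translate; apply/eqP => /(congr1 (horner^~ 0)).
    by rewrite g'E horner0 => /eqP; rewrite oppr_eq0 gt_eqF.
  rewrite (bigD1_seq ((y - s) / c))/= ?rootsR_uniq ?mem_rootsR ?rE ?q0 ?eqxx//.
  rewrite big1_seq => [|x /andP[xy]]; last by rewrite mem_rootsR rE (negbTE xy) andbF.
  by rewrite adde0 mulrC divfK ?gt_eqF// subrK.
rewrite area_formula//; apply: eq_integral => x _.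
by rewrite g'E normrN gtr0_norm// muleC.
Qed.

(** The first index of [C] is that of the variable, as in an expansion of ['X^i] in a basis.
    Indexing by naturals makes the minor without first row and column a mere shift. *)
Definition tri m (C : nat -> nat -> R) (a : 'I_m -> R) : 'I_m -> R :=
  fun l => \sum_(i < m | (l <= i)%N) C i l * a i.

Lemma tri_cons m C (s : R) (t : 'I_m -> R) :
  tri C (cons_pt s t) =
  cons_pt (C 0%N 0%N * s + \sum_(i < m) C i.+1 0%N * t i)
          (tri (fun i l => C i.+1 l.+1) t).
Proof.
apply/funext => l; rewrite /tri big_mkcond big_ord_recl /=.
case: (unliftP ord0 l) => [j|] ->.
  rewrite cons_ptS add0r [RHS]big_mkcond; apply: eq_bigr => i _.
  by rewrite cons_ptS.
by rewrite !cons_pt0; congr (_ + _); apply: eq_bigr => i _; rewrite cons_ptS.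
Qed.

Lemma measurable_tri d (T : measurableType d) m (C : nat -> nat -> T -> R) (a : T -> Rn R m) :
  (forall i l, measurable_fun setT (C i l)) -> measurable_fun setT a ->
  measurable_fun setT (fun t => tri (fun i l => C i l t) (a t) : Rn R m).
Proof.
move=> mC ma; apply: measurable_RnP => l; rewrite /tri.
under eq_fun do rewrite big_mkcond.
apply: measurable_sum => i; case: (l <= i)%N; last exact: measurable_cst.
apply: measurable_funM => //.
exact: (measurableT_comp (measurable_coord i) ma).
Qed.

(** By [tri_cons] only the first component involves the first variable, and it is affine in it with
    slope [C 0 0]; the shift, a function of the other variables, is absorbed by [affine_subst]. *)
Lemma tri_subst m C (F : Rn R m -> \bar R) :
  (forall i, (i < m)%N -> 0 < C i i) ->
  measurable_fun setT F -> (forall x, 0 <= F x)%E ->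
  (iint F = (\prod_(i < m) C i i)%:E * iint (fun a => F (tri C a)))%E.
Proof.
elim: m C F => [|m ih] C F C0 mF F0.
  rewrite big_ord0 mul1e /=; congr F; apply/funext => -[]//.
have C00 := C0 0%N isT.
pose C' i l := C i.+1 l.+1.
have mtri d (T : measurableType d) (t : T -> Rn R m) : measurable_fun setT t ->
    measurable_fun setT (fun x => tri C' (t x) : Rn R m).
  by move=> mt; apply: (@measurable_tri _ _ _ (fun i l => cst (C' i l))).
have mtriC d (T : measurableType d) (t : T -> Rn R m.+1) : measurable_fun setT t ->
    measurable_fun setT (fun x => tri C (t x) : Rn R m.+1).
  by move=> mt; apply: (@measurable_tri _ _ _ (fun i l => cst (C i l))).
have P0 : 0 <= \prod_(i < m) C' i i by apply: prodr_ge0 => i _; rewrite ltW// C0// ltnS.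
have m1 : measurable_fun [set: RR * Rn R m] (fun z => F (cons_pt z.1 (tri C' z.2))).
  apply: (measurableT_comp mF); apply: measurable_cons_pt => //.
  exact: mtri.
have m2 : measurable_fun [set: RR * Rn R m] (fun z => F (tri C (cons_pt z.1 z.2))).
  apply: (measurableT_comp mF); apply: mtriC.
  exact: measurable_cons_pt.
have m3 : measurable_fun [set: Rn R m * RR] (fun z => F (tri C (cons_pt z.2 z.1))).
  apply: (measurableT_comp mF); apply: mtriC.
  exact: measurable_cons_pt.
transitivity (\int[lambda]_s ((\prod_(i < m) C' i i)%:E *
    iint (fun t : 'I_m -> R => F (cons_pt s (tri C' t)))))%E.
  apply: eq_integral => s _; rewrite [LHS](ih C')//; first by move=> i im; exact: C0.
  apply: (measurableT_comp mF).
  by apply: measurable_cons_pt; [exact: measurable_cst|exact: measurable_id].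
rewrite ge0_integralZl//; last 2 first.
- apply: (@measurable_iint R _ RR m (fun s t => F (cons_pt s (tri C' t)))) => //.
- by move=> s _; apply: iint_ge0.
(* Makes the first variable innermost, so that the others are frozen during the affine
   substitution. *)
rewrite (@tonelli_iint R _ RR lambda m (fun s t => F (cons_pt s (tri C' t))))//.
rewrite big_ord_recl mulrC EFinM -muleA; congr (_ * _)%E.
rewrite [X in (_ * X)%E](@tonelli_iint R _ RR lambda m
  (fun s t => F (tri C (cons_pt s t))))//.
rewrite -iintZl//; last 3 first.
- exact: (measurable_fun_fubini_tonelli_F (m2 := lambda)
    (fun z : Rn R m * RR => F (tri C (cons_pt z.2 z.1)))).
- by move=> x; apply: integral_ge0.
- exact: ltW.
apply: eq_iint => t.
rewrite (affine_subst (\sum_(i < m) C i.+1 0%N * t i) C00)//; last first.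
  exact: (@measurable_slice2 _ _ _ RR (Rn R m) _ (fun s u => F (cons_pt s (tri C' u))) m1).
by congr (_ * _)%E; apply: eq_integral => s _; rewrite tri_cons.
Qed.

End triangular.

(** * Change of variables from coefficients to roots *)

Section tuples_of_roots.
Variable R : realType.
Local Notation RR := (measurableTypeR R).
Local Notation lambda := (@lebesgue_measure R).

(** Entries may repeat: every coordinate ranges over the whole list, and the recursion stays
    parallel to that of [iint]. *)
Fixpoint tsum k (s : seq R) : (Rn R k -> \bar R) -> \bar R :=
  match k with
  | 0 => fun F => F (fun=> 0)
  | k'.+1 => fun F =>
      (\sum_(x <- s) tsum s (fun t : Rn R k' => F (cons_pt x t)))%E
  end.

Lemma measurable_tsum d (T : measurableType d) m (a : T -> Rn R m) k
    (F : T -> Rn R k -> \bar R) : measurable_fun setT a ->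
  measurable_fun [set: T * Rn R k] (fun z => F z.1 z.2) ->
  measurable_fun setT (fun t => tsum (rootsR (polyf (a t))) (F t)).
Proof.
elim: k d T a F => [|k ih] d T a F ma mF /=.
  exact: (measurable_slice2 mF).
apply: (measurable_sum_rootsR (H := fun t x => tsum (rootsR (polyf (a t)))
  (fun u : Rn R k => F t (cons_pt x u)))) => //.
apply: (ih _ (T * RR)%type (a \o fst) (fun z u => F z.1 (cons_pt z.2 u))).
  exact: measurableT_comp.
apply: (measurable_comp2 mF); first exact: (measurableT_comp measurable_fst).
apply: measurable_cons_pt => //.
exact: (measurableT_comp measurable_snd measurable_fst).
Qed.

Lemma tsum_ge0 k s (F : Rn R k -> \bar R) :
  (forall x, 0 <= F x)%E -> (0 <= tsum s F)%E.
Proof.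
elim: k F => [|k ih] F F0 //=; apply: sume_ge0 => x _; exact: ih.
Qed.

Lemma eq_tsum k s (F G : Rn R k -> \bar R) : F =1 G -> tsum s F = tsum s G.
Proof. by move=> /funext ->. Qed.

Lemma tsum0 k s : tsum s (fun _ : Rn R k => 0%E) = 0%E.
Proof. by elim: k => //= k ih; rewrite big1. Qed.

Lemma tsumZr k s (F : Rn R k -> \bar R) (c : \bar R) : (forall x, 0 <= F x)%E ->
  tsum s (fun x => F x * c)%E = (tsum s F * c)%E.
Proof.
elim: k F => [|k ih] F F0 //=.
rewrite ge0_sume_distrl; last by move=> x _; exact: tsum_ge0.
by apply: eq_bigr => x _; rewrite ih.
Qed.

Lemma perm_tsum k s1 s2 (F : Rn R k -> \bar R) : perm_eq s1 s2 ->
  tsum s1 F = tsum s2 F.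
Proof.
move=> s12; elim: k F => [|k ih] F //=.
by rewrite (perm_big _ s12); apply: eq_bigr => x _; exact: ih.
Qed.

Lemma tsum_filter k s (y : R) (F : Rn R k -> \bar R) :
  (forall x i, x i = y -> F x = 0%E) ->
  tsum s F = tsum [seq x <- s | x != y] F.
Proof.
elim: k F => [|k ih] F F0 //=.
rewrite big_filter [RHS]big_mkcond/=; apply: eq_bigr => x _.
case: ifPn => [xy|/negbNE/eqP xy].
  by apply: ih => t i ti; apply: (F0 _ (lift ord0 i)); rewrite cons_ptS.
rewrite (@eq_tsum k s _ (fun=> 0%E)) ?tsum0// => t.
by apply: (F0 _ ord0); rewrite cons_pt0.
Qed.

(** [y] may or may not be a root of [q] as well; once the tuples through [y] are discarded, the two
    lists hold the same roots. *)
Lemma tsum_rootsR_mulXsub k (q : {poly R}) (y : R) (F : Rn R k -> \bar R) :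
  (forall x i, x i = y -> F x = 0%E) ->
  tsum (rootsR (('X - y%:P) * q)) F = tsum (rootsR q) F.
Proof.
move=> F0; rewrite (tsum_filter _ F0) [RHS](tsum_filter _ F0).
apply: perm_tsum; apply: uniq_perm; rewrite ?filter_uniq ?rootsR_uniq// => x.
rewrite !mem_filter !mem_rootsR rootM mulf_eq0 negb_or polyXsubC_eq0/=.
by rewrite root_XsubC; case: (eqVneq x y).
Qed.

Definition zpoly k (x : Rn R k) : {poly R} := \prod_(i < k) ('X - (x i)%:P).

Lemma zpoly_cons k (y : R) (x : Rn R k) :
  zpoly (cons_pt y x : Rn R k.+1) = ('X - y%:P) * zpoly x.
Proof.
rewrite /zpoly big_ord_recl cons_pt0; congr (_ * _).
by apply: eq_bigr => i _; rewrite cons_ptS.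
Qed.

Lemma size_zpoly k (x : Rn R k) : size (zpoly x) = k.+1.
Proof. by rewrite size_prod_XsubC /index_enum -enumT size_enum_ord. Qed.

Lemma size_zpoly_polyf k m N (x : Rn R k) (t : Rn R m) : (k + m)%N = N ->
  (size (zpoly x * polyf t)%R <= N)%N.
Proof.
move=> <-; rewrite (leq_trans (size_polyMleq _ _))// size_zpoly addSn/=.
by rewrite leq_add2l size_polyf.
Qed.

Definition jac k m (x : Rn R k) (t : Rn R m) : R :=
  \prod_(i < k) \prod_(j < k | (i < j)%N) `|x i - x j| *
  \prod_(i < k) `|(polyf t).[x i]|.

Lemma jac_ge0 k m (x : Rn R k) (t : Rn R m) : 0 <= jac x t.
Proof. by apply: mulr_ge0; do ?apply: prodr_ge0 => ? _. Qed.

(** Evaluating the quotient [zpoly x * polyf t] at the new root [y] produces at once all the factors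
    by which the Jacobian grows: the distances to the [x i] and the value of [polyf t]. *)
Lemma jac_cons k m (y : R) (x : Rn R k) (t : Rn R m) :
  jac (cons_pt y x : Rn R k.+1) t = `|(zpoly x * polyf t).[y]| * jac x t.
Proof.
rewrite /jac !big_ord_recl !cons_pt0 hornerM normrM horner_prod normr_prod.
have -> : \prod_(j < k.+1 | (@ord0 k < j)%N) `|y - cons_pt y x j| =
    \prod_(i < k) `|('X - (x i)%:P).[y]|.
  rewrite big_mkcond big_ord_recl/= mul1r; apply: eq_bigr => i _.
  by rewrite cons_ptS !hornerE.
have -> : \prod_(i < k) \prod_(j < k.+1 | (lift ord0 i < j)%N)
      `|cons_pt y x (lift ord0 i) - cons_pt y x j| =
    \prod_(i < k) \prod_(j < k | (i < j)%N) `|x i - x j|.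
  apply: eq_bigr => i _; rewrite big_mkcond big_ord_recl/= mul1r [RHS]big_mkcond.
  by apply: eq_bigr => j _; rewrite !cons_ptS.
under [X in _ * (_ * X)]eq_bigr do rewrite cons_ptS.
by rewrite mulrACA.
Qed.

Lemma measurable_coefs_zpoly d (T : measurableType d) k m N (x : T -> Rn R k)
    (t : T -> Rn R m) : measurable_fun setT x -> measurable_fun setT t ->
  measurable_fun setT (fun u => coefs N (zpoly (x u) * polyf (t u)) : Rn R N).
Proof.
move=> mx mt.
have mz j : measurable_fun setT (fun u => (zpoly (x u))`_j).
  elim: k x mx j => [|k ih] x mx j.
    under eq_fun do rewrite /zpoly big_ord0 coef1.
    exact: measurable_cst.
  have mtl : measurable_fun setT (fun u => (fun i => x u (lift ord0 i)) : Rn R k).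
    by apply: measurable_RnP => i; exact: (measurableT_comp (measurable_coord _) mx).
  have m0 : measurable_fun setT (fun u => x u ord0).
    exact: (measurableT_comp (measurable_coord _) mx).
  under eq_fun => u.
    rewrite -(cons_pt_eta (x u)) zpoly_cons mulrBl coefB coefXM coefCM; over.
  apply: measurable_funB.
    by case: (j == 0)%N; [exact: measurable_cst|exact: ih].
  by apply: measurable_funM => //; exact: ih.
have mp j : measurable_fun setT (fun u => (polyf (t u))`_j).
  have [jm|mj] := ltnP j m.
    under eq_fun do rewrite (coef_polyf _ (Ordinal jm)).
    exact: (measurableT_comp (measurable_coord _) mt).
  under eq_fun do rewrite nth_default ?(leq_trans (size_polyf _))//.
  exact: measurable_cst.
apply: measurable_RnP => i; rewrite /coefs.
under eq_fun do rewrite coefM.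
by apply: measurable_sum => j; exact: measurable_funM.
Qed.

Lemma measurable_jac d (T : measurableType d) k m (x : T -> Rn R k)
    (t : T -> Rn R m) : measurable_fun setT x -> measurable_fun setT t ->
  measurable_fun setT (fun u => jac (x u) (t u)).
Proof.
move=> mx mt.
have mxi i : measurable_fun setT (fun u => x u i).
  exact: (measurableT_comp (measurable_coord i) mx).
apply: measurable_funM.
  apply: measurable_prod => i _; under eq_fun do rewrite big_mkcond.
  apply: measurable_prod => j _; case: (i < j)%N; last exact: measurable_cst.
  apply: measurableT_comp => //; exact: measurable_funB.
apply: measurable_prod => i _; apply: measurableT_comp => //.
exact: measurable_horner_polyf.
Qed.

Lemma size_mulXsub_polyf m (x : R) (a : Rn R m) :
  (size (('X - x%:P) * polyf a)%R <= m.+1)%N.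
Proof.
rewrite (leq_trans (size_polyMleq _ _))// size_XsubC.
by rewrite addSn add1n ltnS size_polyf.
Qed.

Lemma deriv_polyf m (a : 'I_m -> R) x :
  (polyf a)^`().[x] = \sum_(i < m) a i * (x ^+ i.-1 *+ i).
Proof.
rewrite /polyf raddf_sum horner_sum; apply: eq_bigr => i _.
by rewrite /= derivZ derivXn hornerZ hornerMn hornerXn.
Qed.

(* Integrate first over the constant coefficient (area formula), which solves for it
   in terms of the root [x]; the other coefficients are then a unitriangular image of
   those of the quotient by ['X - x%:P]. *)
Lemma one_root N (H : RR -> Rn R N.+1 -> \bar R) :
  measurable_fun [set: RR * Rn R N.+1] (fun z => H z.1 z.2) ->
  (forall x a, 0 <= H x a)%E ->
  (iint (fun a => \sum_(x <- rootsR (polyf a)) H x a) =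
   \int[lambda]_x iint (fun b : Rn R N =>
     H x (coefs N.+1 (('X - x%:P) * polyf b)) * (`|(polyf b).[x]|)%:E))%E.
Proof.
move=> mH H0 /=.
pose g (a' : Rn R N) : {poly R} := 'X * polyf a'.
have gE a' x : (g a').[x] = x * (polyf a').[x] by rewrite hornerM hornerX.
have dgE a' x : (g a')^`().[x] = (polyf a').[x] + x * (polyf a')^`().[x].
  by rewrite derivM derivX mul1r !hornerE.
(* The constant coefficient is replaced by the value that the root [x] forces, so the summand
   depends on [x] and [a'] alone and the area formula applies in [y]. *)
pose psi (a' : Rn R N) (x : RR) : \bar R := H x (cons_pt (- (g a').[x]) a').
have mga d (T : measurableType d) (a : T -> Rn R N) (x : T -> RR) :
    measurable_fun setT a -> measurable_fun setT x ->
    measurable_fun setT (fun t => (g (a t)).[x t]).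
  move=> ma mx; under eq_fun do rewrite gE.
  by apply: measurable_funM => //; exact: measurable_horner_polyf.
have mpsi d (T : measurableType d) (a : T -> Rn R N) (x : T -> RR) :
    measurable_fun setT a -> measurable_fun setT x ->
    measurable_fun setT (fun t => psi (a t) (x t)).
  move=> ma mx; apply: (measurable_comp2 mH) => //.
  by apply: measurable_cons_pt => //; apply: measurableT_comp => //; exact: mga.
have mdg d (T : measurableType d) (a : T -> Rn R N) (x : T -> RR) :
    measurable_fun setT a -> measurable_fun setT x ->
    measurable_fun setT (fun t => `|(g (a t))^`().[x t]|).
  move=> ma mx; apply: measurableT_comp => //.
  under eq_fun do rewrite dgE.
  apply: measurable_funD; first exact: measurable_horner_polyf.
  apply: measurable_funM => //.
  under eq_fun do rewrite deriv_polyf.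
  apply: measurable_sum => i; apply: measurable_funM.
    exact: (measurableT_comp (measurable_coord i) ma).
  under eq_fun do rewrite -mulr_natr.
  by apply: measurable_funM => //; exact: measurable_funX.
rewrite (@tonelli_iint R _ RR lambda N (fun y a' =>
    \sum_(x <- rootsR (polyf (cons_pt y a' : Rn R N.+1))) H x (cons_pt y a')))%E;
  last 2 first.
- apply: (measurable_sum_rootsR (a := fun z : RR * Rn R N => cons_pt z.1 z.2)
      (H := fun z x => H x (cons_pt z.1 z.2))); first exact: measurable_cons_pt.
  apply: (measurable_comp2 mH) => //.
  apply: measurable_cons_pt; first exact: (measurableT_comp measurable_fst).
  exact: (measurableT_comp measurable_snd).
- by move=> y a'; apply: sume_ge0.
transitivity (iint (fun a' : Rn R N =>
  \int[lambda]_x (psi a' x * (`|(g a')^`().[x]|)%:E)))%E.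
  apply: eq_iint => a'.
  rewrite -(@area_formula R (g a') (psi a')); last 2 first.
  - by apply: (mpsi _ RR); [exact: measurable_cst|exact: measurable_id].
  - by move=> x; exact: H0.
  apply: eq_integral => y _; rewrite polyf_cons; apply: eq_big_seq => x.
  rewrite mem_rootsR => /andP[_]; rewrite rootE hornerD hornerC addr_eq0 => /eqP ->.
  by [].
rewrite -(@tonelli_iint R _ RR lambda N
  (fun x a' => psi a' x * (`|(g a')^`().[x]|)%:E))%E; last 2 first.
- apply: emeasurable_funM; first exact: mpsi.
  by apply/measurable_EFinP; exact: mdg.
- by move=> x a'; rewrite mule_ge0 ?lee_fin//; exact: H0.
apply: eq_integral => x _.
(* Coefficient [l + 1] of [('X - x) * b] is [b_l - x b_(l+1)]; the unit diagonal means that this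
   substitution costs no factor. *)
pose C (i l : nat) : R := if i == l then 1 else if i == l.+1 then - x else 0.
rewrite (@tri_subst R N C); last 3 first.
- by move=> i _; rewrite /C eqxx.
- apply: emeasurable_funM; first by apply: mpsi => //; exact: measurable_cst.
  by apply/measurable_EFinP; apply: mdg => //; exact: measurable_cst.
- by move=> a'; rewrite mule_ge0 ?lee_fin//; exact: H0.
rewrite big1 ?mul1e => [|i _]; last by rewrite /C eqxx.
apply: eq_iint => b.
set A := ('X - x%:P) * polyf b.
have sA : (size A <= N.+1)%N by exact: size_mulXsub_polyf.
have tE : tri C b = fun l : 'I_N => A`_l.+1.
  apply/funext => l; rewrite /A mulrBl coefB coefXM coefCM/= coef_polyf.
  rewrite /tri (bigD1 l)//= {1}/C eqxx mul1r; congr (_ + _).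
  have [lN|Nl] := ltnP l.+1 N.
    rewrite (coef_polyf b (Ordinal lN)) (bigD1 (Ordinal lN))/=; last first.
      by rewrite leqnSn/= -val_eqE/= gtn_eqF.
    rewrite {1}/C gtn_eqF// eqxx mulNr big1 ?addr0// => i.
    rewrite -!val_eqE/= => /andP[/andP[_ il] iSl].
    by rewrite /C (negbTE il) (negbTE iSl) mul0r.
  (* At the last [l], [b] has no coefficient of degree [l + 1], and only the diagonal entry
     remains. *)
  rewrite (nth_default _ (leq_trans (size_polyf _) Nl)) mulr0 oppr0 big1// => i.
  rewrite -val_eqE/= => /andP[li il]; have := leq_trans (ltn_ord i) Nl.
  by rewrite ltnS leq_eqVlt (negbTE il)/= ltnNge li.
have cE : coefs N.+1 A = cons_pt A`_0 (tri C b).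
  rewrite tE; apply/funext => i; case: (unliftP ord0 i) => [j|] ->.
    by rewrite cons_ptS.
  by rewrite cons_pt0.
have AE : A = (A`_0)%:P + g (tri C b) by rewrite /g -polyf_cons -cE polyfK.
have Ax0 : A`_0 = - (g (tri C b)).[x].
  apply/eqP; rewrite -addr_eq0 -(hornerC A`_0 x) -hornerD -AE.
  by rewrite hornerM hornerXsubC subrr mul0r.
rewrite /psi -Ax0 -cE; congr (_ * (`|_|)%:E)%E.
(* [A] and [g (tri C b)] differ by a constant, so the factor of the area formula is [A'(x)], which
   is [b(x)] because [A = ('X - x) * b]. *)
have /(congr1 (@deriv _))/(congr1 (horner^~ x)) := AE.
rewrite derivD derivC add0r => <-.
by rewrite derivM derivXsubC mul1r hornerD hornerM hornerXsubC subrr mul0r addr0.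
Qed.

(* One root is divided out at a time. Since [H] vanishes at non-injective [x], a root
   of the quotient equal to an earlier root does not contribute. *)
Lemma roots_change_of_variables k m N (H : Rn R k -> Rn R N -> \bar R) :
  (k + m)%N = N ->
  measurable_fun [set: Rn R k * Rn R N] (fun z => H z.1 z.2) ->
  (forall x a, 0 <= H x a)%E -> (forall x a, ~ injective x -> H x a = 0%E) ->
  iint (fun a : Rn R N => tsum (rootsR (polyf a)) (H ^~ a)) =
  iint (fun x : Rn R k => iint (fun t : Rn R m =>
    H x (coefs N (zpoly x * polyf t)) * (jac x t)%:E))%E.
Proof.
elim: k N H => [|k ih] N H /= kmN mH H0 Hinj.
  rewrite add0n in kmN; subst N; apply: eq_iint => t.
  by rewrite /jac !big_ord0 mulr1 mule1 /zpoly big_ord0 mul1r coefsK.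
case: N kmN H mH H0 Hinj => // N [kmN] H mH H0 Hinj.
rewrite [LHS](@one_root N (fun x a => tsum (rootsR (polyf a))
    (fun x' : Rn R k => H (cons_pt x x') a))); last 2 first.
- apply: (measurable_tsum (a := fun z : RR * Rn R N.+1 => z.2)
    (F := fun z u => H (cons_pt z.1 u) z.2)); first exact: measurable_snd.
  apply: (measurable_comp2 mH).
    by apply: measurable_cons_pt => //; exact: (measurableT_comp measurable_fst).
  exact: (measurableT_comp measurable_snd).
- by move=> x a; apply: tsum_ge0.
apply: eq_integral => y _.
pose H' (x : Rn R k) (b : Rn R N) : \bar R :=
  (H (cons_pt y x) (coefs N.+1 (('X - y%:P) * polyf b)) * (`|(polyf b).[y]|)%:E)%E.
transitivity (iint (fun b : Rn R N => tsum (rootsR (polyf b)) (H' ^~ b))).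
  apply: eq_iint => b; rewrite polyfK; last exact: size_mulXsub_polyf.
  rewrite tsum_rootsR_mulXsub; last first.
    move=> x i xi; apply: Hinj => /(_ (lift ord0 i) ord0).
    rewrite cons_ptS cons_pt0 => /(_ xi)/eqP.
    by rewrite eq_sym (negbTE (neq_lift _ _)).
  by rewrite -tsumZr.
rewrite (ih N)//; last 3 first.
- apply: emeasurable_funM; last first.
    apply/measurable_EFinP; apply: measurableT_comp => //.
    by apply: measurable_horner_polyf => //; exact: measurable_cst.
  apply: (measurable_comp2 mH).
    by apply: measurable_cons_pt => //; exact: measurable_cst.
  (* Read as the [zpoly] of a one-entry tuple, the linear factor falls under
     [measurable_coefs_zpoly]. *)
  have -> : 'X - y%:P = zpoly ((fun=> y) : Rn R 1) by rewrite /zpoly big_ord1.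
  by apply: measurable_coefs_zpoly => //; exact: measurable_cst.
- by move=> x b; rewrite /H' mule_ge0 ?lee_fin.
- move=> x b nx; rewrite /H' Hinj ?mul0e// => inj; apply: nx => i j xij.
  by have := inj (lift ord0 i) (lift ord0 j); rewrite !cons_ptS => /(_ xij)/lift_inj.
apply: eq_iint => x; apply: eq_iint => t.
rewrite /H' polyfK; last exact: size_zpoly_polyf.
(* At [b = zpoly x * polyf t], the factor [|b(y)|] is exactly the one that extends [jac x t] to the
   tuple with [y]. *)
by rewrite jac_cons (EFinM _ (jac x t)) muleA zpoly_cons -mulrA.
Qed.

End tuples_of_roots.

(** * The joint density of the random coefficients *)

Section joint_density.
Variable R : realType.
Local Notation RR := (measurableTypeR R).
Local Notation lambda := (@lebesgue_measure R).

Lemma iint_prod m (phi : nat -> R -> R) :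
  (forall i, (i < m)%N -> measurable_fun setT (phi i)) ->
  (forall i y, (i < m)%N -> 0 <= phi i y) ->
  (iint (fun t : Rn R m => (\prod_(i < m) phi i (t i))%:E) =
   \prod_(i < m) \int[lambda]_s (phi i s)%:E)%E.
Proof.
elim: m phi => [|m ih] phi mphi phi0 /=; first by rewrite !big_ord0.
pose h (t : Rn R m) : \bar R := (\prod_(i < m) phi i.+1 (t i))%:E.
have h0 t : (0 <= h t)%E by rewrite lee_fin prodr_ge0// => i _; apply: phi0; rewrite ltnS.
have mh : measurable_fun setT h.
  apply/measurable_EFinP; apply: measurable_prod => i _.
  apply: (measurableT_comp (mphi i.+1 _)); first by rewrite ltnS.
  exact: measurable_coord.
transitivity (\int[lambda]_s ((phi 0%N s)%:E * iint h))%E.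
  apply: eq_integral => s _; rewrite -iintZl//; last exact: phi0.
  apply: eq_iint => t; rewrite big_ord_recl cons_pt0 EFinM; congr (_ * (_)%:E)%E.
  by apply: eq_bigr => i _; rewrite cons_ptS.
rewrite ge0_integralZr//; last 3 first.
- by apply/measurable_EFinP; exact: mphi.
- by move=> s _; rewrite lee_fin phi0.
- exact: iint_ge0.
rewrite big_ord_recl; congr (_ * _)%E.
rewrite /h (ih (fun i => phi i.+1))// => i *.
  exact: mphi.
exact: phi0.
Qed.

(** A pi-system generating the sigma-algebra; the sides form a sequence over [nat] to match the
    independence hypothesis. *)
Definition box m : set (set (Rn R m)) :=
  [set B | exists2 A : nat -> set R, (forall i, measurable (A i)) &
                                     B = [set t | forall i : 'I_m, A i (t i)]].

Lemma measurable_box m B : @box m B -> measurable B.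
Proof.
move=> [A mA ->].
rewrite (_ : [set t | _] = \bigcap_(i in [set: 'I_m]) ((fun t : Rn R m => t i) @^-1` A i)).
  apply: fin_bigcap_measurable => // i _.
  by rewrite -[X in measurable X]setTI; exact: measurable_coord.
by apply/seteqP; split=> t H i; [move=> _; exact: H|exact: H].
Qed.

Lemma box_generates m : @measurable _ (Rn R m) = <<s @box m >>.
Proof.
apply/seteqP; split; last first.
  apply: smallest_sub; first exact: sigma_algebra_measurable.
  by move=> B; exact: measurable_box.
apply: smallest_sub; first exact: smallest_sigma_algebra.
rewrite -bigcup_seq; apply: bigcup_sub => i _ _ [C mC <-].
apply: sub_sigma_algebra; rewrite setTI.
exists (fun j : nat => if j == i :> nat then C else setT) => [j|]; first by case: ifP.
apply/seteqP; split=> t /=.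
  by move=> Ct j; case: ifPn => // /eqP/val_inj ->.
by move/(_ i); rewrite eqxx.
Qed.

Lemma setI_closed_box m : setI_closed (@box m).
Proof.
move=> _ _ [A mA ->] [B mB ->]; exists (fun i => A i `&` B i).
  by move=> i; exact: measurableI.
apply/seteqP; split=> t /=; first by move=> [HA HB] i.
by move=> H; split=> i; have [] := H i.
Qed.

Lemma box_setT m : @box m setT.
Proof. by exists (fun=> setT) => //; apply/seteqP; split. Qed.

Section law.
Context (n : nat) d (Omega : measurableType d) (P : probability Omega R).
Variables (xi : nat -> Omega -> R) (f : nat -> R -> R).
Hypothesis hxi_meas : forall i, (i <= n)%N -> measurable_fun setT (xi i).
Hypothesis hf_meas : forall i, (i <= n)%N -> measurable_fun setT (f i).
Hypothesis hf_ge0 : forall i, (i <= n)%N -> forall y, 0 <= f i y.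
Hypothesis hdens : forall i, (i <= n)%N -> forall A : set R, measurable A ->
     P (xi i @^-1` A) = (\int[@lebesgue_measure R]_(y in A) (f i y)%:E)%E.
Hypothesis hindep : forall A : nat -> set R, (forall i, measurable (A i)) ->
     P (\bigcap_(i in [set i : nat | (i <= n)%N]) (xi i @^-1` A i))
     = (\prod_(i < n.+1) P (xi i @^-1` A i))%E.

Definition xivec (w : Omega) : Rn R n.+1 := fun i => xi i w.

Lemma measurable_xivec : measurable_fun setT xivec.
Proof. by apply: measurable_RnP => i; apply: hxi_meas; rewrite -ltnS. Qed.

Definition joint_pdf (t : Rn R n.+1) : R := \prod_(l < n.+1) f l (t l).

Lemma joint_pdf_ge0 t : 0 <= joint_pdf t.
Proof. by apply: prodr_ge0 => l _; apply: hf_ge0; rewrite -ltnS. Qed.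

Lemma measurable_joint_pdf : measurable_fun setT joint_pdf.
Proof.
apply: measurable_prod => l _.
apply: (measurableT_comp (hf_meas _)); first by rewrite -ltnS.
exact: measurable_coord.
Qed.

(** The law of [xivec] and the measure with density [joint_pdf] agree on boxes, where independence
    factors the first and Tonelli the second. *)
Lemma joint_density (F : Rn R n.+1 -> \bar R) : measurable_fun setT F ->
  (forall x, 0 <= F x)%E ->
  (\int[P]_w F (xivec w) = iint (fun t => F t * (joint_pdf t)%:E))%E.
Proof.
move=> mF F0.
rewrite iintE; last 2 first.
- apply: emeasurable_funM => //; apply/measurable_EFinP.
  exact: measurable_joint_pdf.
- by move=> x; rewrite mule_ge0// lee_fin joint_pdf_ge0.
rewrite -(ge0_integral_image P measurable_xivec)//.
rewrite -(ge0_integral_density (lebn R n.+1) measurable_joint_pdf joint_pdf_ge0)//.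
apply: eq_measure_integral => B mB _.
(* The law is a probability, so the whole space serves as a constant exhausting sequence. *)
refine (@measure_unique _ R (Rn R n.+1) (@box n.+1) (fun=> setT) (@box_generates _)
  (@setI_closed_box _) _ _ (image_measure P measurable_xivec)
  (density_measure (lebn R n.+1) measurable_joint_pdf joint_pdf_ge0) _ _ B mB).
- by move=> _; exact: box_setT.
- by apply/seteqP; split => // t _; exists 0%N.
- move=> A bA; have mA := measurable_box bA.
  case: bA mA => {}A mA0 -> mA.
  transitivity (P (\bigcap_(i in [set i : nat | (i <= n)%N]) (xi i @^-1` A i))).
    congr (P _); apply/seteqP; split=> w /= H.
      by move=> i /= ilen; have := H (Ordinal (ilen : (i < n.+1)%N)).
    by move=> i; apply: (H i); rewrite /= -ltnS.
  rewrite hindep// /density_measure/= /density integral_mkcond/=.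
  (* With the indicator of each side moved into its factor, the integrand remains a product of
     one-variable functions. *)
  pose phi i y : R := f i y * \1_(A i) y.
  transitivity (\prod_(i < n.+1) \int[lambda]_s (phi i s)%:E)%E.
    apply: eq_bigr => i _; rewrite hdens//; last by rewrite -ltnS.
    rewrite integral_mkcond; apply: eq_integral => y _.
    by rewrite patchE /phi indicE; case: ifPn => _; rewrite ?mulr1 ?mulr0.
  rewrite -iint_prod; last 2 first.
  - move=> i im; apply: measurable_funM; first exact: hf_meas.
    exact: measurable_indic.
  - by move=> i y im; rewrite mulr_ge0// hf_ge0.
  rewrite iintE; last 2 first.
  - apply/measurable_EFinP; apply: measurable_prod => i _; apply: measurable_funM.
      apply: (measurableT_comp (hf_meas _)); first by rewrite -ltnS.
      exact: measurable_coord.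
    have mI : measurable_fun setT (\1_(A i) : R -> R) by exact: measurable_indic.
    exact: (measurableT_comp mI (measurable_coord i)).
  - by move=> t; rewrite lee_fin prodr_ge0// => i _; rewrite mulr_ge0// hf_ge0// -ltnS.
  apply: eq_integral => t _; rewrite patchE /phi big_split/=.
  case: ifPn => [|/negP]; rewrite inE/= => H.
    rewrite [X in (_ * X)%:E]big1 ?mulr1// => i _.
    by rewrite indicE mem_set.
  have /existsNP[i nAi] := H.
  by rewrite [X in (_ * X)%:E](bigD1 i)//= indicE memNset// mul0r mulr0.
- move=> _; rewrite /image_measure/= /pushforward preimage_setT probability_setT.
  exact: ltry.
Qed.

End law.
End joint_density.

(** * Coefficients in the orthonormal basis *)

Section orthonormal_expansion.
Variables (R : realType) (mu : {measure set (measurableTypeR R) -> \bar R}).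
Hypothesis hmom : forall m : nat, mu.-integrable setT (fun x : R => (x ^+ m)%:E).
Variable p : nat -> {poly R}.
Hypothesis hdeg : forall i : nat, size (p i) = i.+1.
Hypothesis hlead : forall i : nat, 0 < lead_coef (p i).
Hypothesis horth : forall i j : nat,
  ip mu (fun y => (p i).[y]) (fun y => (p j).[y]) = (i == j)%:R.

Lemma integrable_horner (q : {poly R}) :
  mu.-integrable setT (fun x => (q.[x])%:E).
Proof.
rewrite [X in mu.-integrable _ X](_ : _ =
    (fun x => \sum_(i < size q) (q`_i)%:E * (x ^+ i)%:E)%E); last first.
  apply/funext => x; rewrite horner_coef -sumEFin.
  by apply: eq_bigr => i _; rewrite EFinM.
by apply: integrable_sum => // i _; exact: integrableZl.
Qed.

(** Finite moments make integration a linear functional on polynomials, so orthonormality can be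
    exploited algebraically. *)
Let moment (q : {poly R}) : R := Rintegral mu setT (horner q).

Let momentD q1 q2 : moment (q1 + q2) = moment q1 + moment q2.
Proof.
rewrite /moment -RintegralD//; try exact: integrable_horner.
by congr (Rintegral _ _ _); apply/funext => x; rewrite hornerD.
Qed.

Let momentZ c q : moment (c *: q) = c * moment q.
Proof.
rewrite /moment -RintegralZl//; try exact: integrable_horner.
by congr (Rintegral _ _ _); apply/funext => x; rewrite hornerZ.
Qed.

Let moment0 : moment 0 = 0.
Proof. by have := momentZ 0 0; rewrite scale0r mul0r. Qed.

Let moment_sum m (F : 'I_m -> {poly R}) : moment (\sum_i F i) = \sum_i moment (F i).
Proof. exact: (big_morph _ momentD moment0). Qed.

Let ip_moment q1 q2 : ip mu (fun y => q1.[y]) (fun y => q2.[y]) = moment (q1 * q2).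
Proof.
by congr (Rintegral _ _ _); apply/funext => x; rewrite hornerM.
Qed.

(** A multiple of [p m] removes the coefficient of degree [m], and induction spans the remainder. *)
Lemma span_poly m (q : {poly R}) : (size q <= m)%N ->
  exists c : nat -> R, q = \sum_(l < m) c l *: p l.
Proof.
elim: m q => [|m ih] q qm.
  by exists (fun=> 0); rewrite big_ord0; apply/eqP; rewrite -size_poly_leq0.
have pm0 : (p m)`_m != 0 by rewrite -[X in _`_X]/(m.+1.-1) -hdeg -lead_coefE gt_eqF.
have [|c cE] := ih (q - (q`_m / (p m)`_m) *: p m).
  apply/leq_sizeP => j; rewrite leq_eqVlt => /predU1P[<-|mj].
    by rewrite coefB coefZ divfK ?subrr.
  rewrite coefB coefZ (nth_default _ (leq_trans qm mj)).
  rewrite (nth_default _ (_ : size (p m) <= j)%N) ?hdeg//.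
  by rewrite mulr0 subr0.
exists (fun l => if l == m then q`_m / (p m)`_m else c l).
rewrite big_ord_recr/= eqxx -[LHS](subrK ((q`_m / (p m)`_m) *: p m)) cE.
by congr (_ + _); apply: eq_bigr => l _; rewrite ltn_eqF.
Qed.

Definition monomial_coef (i l : nat) : R := ip mu (fun y => y ^+ i) (fun y => (p l).[y]).

(** Pairing with [p l] identifies the coefficients; the degree bound [l <= i] is the triangularity
    of the change of basis. *)
Lemma monomial_expansion i :
  'X^i = \sum_(l < i.+1) monomial_coef i l *: p l.
Proof.
have [|c cE] := @span_poly i.+1 'X^i; first by rewrite size_polyXn.
rewrite {1}cE; apply: eq_bigr => l _; congr (_ *: _).
rewrite /monomial_coef.
have -> : (fun y : measurableTypeR R => y ^+ i) = (fun y => ('X^i : {poly R}).[y]).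
  by apply/funext => y; rewrite hornerXn.
rewrite ip_moment cE mulr_suml moment_sum (bigD1 l)//= -scalerAl momentZ.
rewrite -ip_moment horth eqxx mulr1 big1 ?addr0// => j jl.
by rewrite -scalerAl momentZ -ip_moment horth -[_ == _ :> nat]/(j == l) (negbTE jl) mulr0.
Qed.

(** Only [p i] reaches degree [i] in the expansion of ['X^i]. These positive diagonal entries are
    the source of the inverse leading coefficients in the formula. *)
Lemma monomial_coef_diag i : monomial_coef i i = (lead_coef (p i))^-1.
Proof.
have /(congr1 (fun q : {poly R} => q`_i)) := monomial_expansion i.
rewrite coefXn eqxx coef_sum big_ord_recr/= big1 => [|l _]; last first.
  by rewrite coefZ nth_default ?mulr0// hdeg.
rewrite add0r coefZ => /esym E; have l0 : lead_coef (p i) != 0 by rewrite gt_eqF.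
by apply: (mulIf l0); rewrite mulVf// lead_coefE hdeg.
Qed.

Definition pcomb m (t : Rn R m) : {poly R} := \sum_(i < m) t i *: p i.

(** Coordinates in the basis [p] are thus [tri monomial_coef] of the monomial coefficients; each
    [f l] in the formula is evaluated at such a coordinate. *)
Lemma pcomb_tri m (a : Rn R m) : pcomb (tri monomial_coef a) = polyf a.
Proof.
rewrite /pcomb /polyf /tri.
under eq_bigr do rewrite scaler_suml big_mkcond.
rewrite exchange_big/=; apply: eq_bigr => i _.
rewrite monomial_expansion scaler_sumr.
rewrite (big_ord_widen m (fun l => a i *: (monomial_coef i l *: p l)))//.
rewrite [RHS]big_mkcond/=; apply: eq_bigr => l _; rewrite ltnS.
by case: leqP => // _; rewrite scalerA mulrC.
Qed.

Lemma size_pcomb m (t : Rn R m) : (size (pcomb t) <= m)%N.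
Proof.
apply: (leq_trans (size_sum _ _ _)); apply/bigmax_leqP => i _.
by rewrite (leq_trans (size_scale_leq _ _))// hdeg.
Qed.

Lemma measurable_coefs_pcomb m : measurable_fun setT
  (fun t : Rn R m => coefs m (pcomb t) : Rn R m).
Proof.
apply: measurable_RnP => i; rewrite /coefs.
under eq_fun do rewrite coef_sum.
apply: measurable_sum => l; under eq_fun do rewrite coefZ.
by apply: measurable_funM; [exact: measurable_coord|exact: measurable_cst].
Qed.

End orthonormal_expansion.

(** * Vieta's formulas *)

Section symmetric_functions.
Variable R : realType.

(* [esym] alone would be symmetry of equality, from [ssrfun]. *)
Lemma esym_gt k (x : Rn R k) (m : nat) : (k < m)%N -> Defs.esym x m = 0.
Proof.
move=> km; rewrite /Defs.esym big_pred0// => A; apply/negbTE.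
by rewrite neq_ltn (leq_ltn_trans (max_card _))// card_ord.
Qed.

(** In the expanded product, choosing [- x i] for [i] in [A] and ['X] elsewhere contributes to
    degree [k - #|A|] only. *)
Lemma coef_zpoly k (x : Rn R k) (d : nat) : (d <= k)%N ->
  (zpoly x)`_d = (-1) ^+ (k - d) * Defs.esym x (k - d)%N.
Proof.
move=> dk; rewrite /zpoly.
under eq_bigr do rewrite addrC.
rewrite bigA_distr/= coef_sum /Defs.esym big_distrr/= [RHS]big_mkcond/=.
apply: eq_bigr => A _.
have -> : \prod_(i < k) (if i \in A then - (x i)%:P else 'X) =
    ((-1) ^+ #|A| * \prod_(i in A) x i)%:P * 'X^(k - #|A|).
  rewrite (bigID (mem A))/=; congr (_ * _).
    rewrite (eq_bigr (fun i => (- x i)%:P)) => [|i ->]; last by rewrite polyCN.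
    by rewrite -rmorph_prod prodrN.
  rewrite (eq_bigr (fun=> 'X)) => [|i /negbTE->//].
  rewrite prodr_const; congr ('X^_).
  by rewrite -[X in (X - _)%N](card_ord k) -(cardC A) addKn.
have Ak : (#|A| <= k)%N by rewrite -[X in (_ <= X)%N](card_ord k) max_card.
rewrite coefCM coefXn (_ : (d == k - #|A|)%N = (#|A| == k - d)%N); last first.
  by apply/eqP/eqP => ->; rewrite subKn.
by case: eqP => [->|_]; rewrite ?mulr1 ?mulr0.
Qed.

(** [t j] multiplies the coefficient of degree [i - j] of [zpoly x], whose codegree is [k - i + j].
    Beyond [k] (when [i < j]) and below zero (past the degree of [zpoly x]) both sides vanish; in
    between, Vieta applies. *)
Lemma coef_zpoly_polyf k m (x : Rn R k) (t : Rn R m) (i : nat) :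
  (zpoly x * polyf t)`_i =
  \sum_(j < m) (-1) ^ (k%:Z - i%:Z + j%:Z) * Defs.esym x (k%:Z - i%:Z + j%:Z) * t j.
Proof.
rewrite /polyf mulr_sumr coef_sum; apply: eq_bigr => j _.
rewrite -scalerAr coefZ coefMXn mulrC; congr (_ * _).
case: ltnP => [ij|ji].
  have -> : k%:Z - i%:Z + j%:Z = (k + (j - i))%N%:Z by lia.
  by rewrite esym_gt ?mulr0// -[X in (X < _)%N]addn0 ltn_add2l subn_gt0.
have [dk|kd] := leqP (i - j) k.
  have -> : k%:Z - i%:Z + j%:Z = (k - (i - j))%N%:Z by lia.
  by rewrite coef_zpoly.
have -> : k%:Z - i%:Z + j%:Z = Negz ((i - j) - k).-1 by lia.
by rewrite mulr0 nth_default// size_zpoly.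
Qed.

End symmetric_functions.

(** * Sums over tuples of zeros and test functions *)

Section zero_tuples.
Variable R : realType.

Lemma row_ord0 k (x : Rn R k) : (\row_i x i) ord0 = x.
Proof. by apply/funext => i; rewrite mxE. Qed.

Fixpoint tuples_of k (s : seq R) : seq 'rV[R]_k :=
  match k with
  | 0 => [:: \row_i 0]
  | k'.+1 => [seq (\row_i cons_pt x (t ord0) i : 'rV[R]_k'.+1) | x : R <- s,
              t : 'rV[R]_k' <- tuples_of k' s]
  end.

Lemma tsum_tuples k s (F : Rn R k -> \bar R) :
  tsum s F = (\sum_(x <- tuples_of k s) F (x ord0))%E.
Proof.
elim: k F => [|k ih] F /=.
  by rewrite big_seq1; congr F; apply/funext => -[].
rewrite big_allpairs_dep; apply: eq_bigr => x _; rewrite ih.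
by apply: eq_bigr => t _; rewrite row_ord0.
Qed.

Lemma mem_tuples_of k s (x : 'rV[R]_k) :
  (x \in tuples_of k s) = [forall i, x ord0 i \in s].
Proof.
elim: k x => [|k ih] x /=.
  rewrite inE; have -> : x = \row_i 0 by apply/rowP => -[].
  by rewrite eqxx; apply/esym/forallP => -[].
apply/allpairsP/forallP => [[[y t] /= [ys ts ->]] i|H].
  rewrite mxE; case: (unliftP ord0 i) => [j|] ->; last by rewrite cons_pt0.
  by rewrite cons_ptS; move: ts; rewrite ih => /forallP.
exists (x ord0 ord0, \row_i x ord0 (lift ord0 i)); split => /=.
- exact: H.
- by rewrite ih; apply/forallP => i; rewrite mxE.
- by apply/rowP => i; rewrite mxE row_ord0 cons_pt_eta.
Qed.

Lemma uniq_tuples_of k s : uniq s -> uniq (tuples_of k s).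
Proof.
move=> us; elim: k => [|k ih] //=; apply: allpairs_uniq => //.
move=> [x t] [y u] /= _ _ /rowP E; congr pair.
  by have := E ord0; rewrite !mxE !cons_pt0.
by apply/rowP => i; have := E (lift ord0 i); rewrite !mxE !cons_ptS.
Qed.

Lemma size_tuples_of k s : size (tuples_of k s) = (size s ^ k)%N.
Proof. by elim: k => //= k ih; rewrite size_allpairs ih expnS. Qed.

Lemma sum_over_zero_tuplesE k (Q : {poly R}) (G : 'rV[R]_k -> R) : (0 < k)%N ->
  sum_over_zero_tuples Q G =
  \sum_(x <- tuples_of k (rootsR Q) | `[< injective (x ord0) >]) G x.
Proof.
move=> k0; rewrite /sum_over_zero_tuples; have [->|Q0/=] := eqVneq Q 0.
  (* On the zero polynomial the convention gives 0, and an empty list has no tuple of positive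
     length; for [k = 0] the empty tuple would remain. *)
  by rewrite rootsR0; case: k k0 G => // k _ G; rewrite big_nil.
rewrite -[RHS]big_filter [RHS]fsbig_seq ?filter_uniq ?uniq_tuples_of ?rootsR_uniq//.
apply: eq_fsbigl; apply/seteqP; split=> x /=; rewrite mem_filter mem_tuples_of.
  move=> [rx ix]; apply/andP; split; first exact/asboolP.
  by apply/forallP => i; rewrite mem_rootsR Q0 rx.
move=> /andP[/asboolP ix /forallP rx]; split => // i.
by have := rx i; rewrite mem_rootsR => /andP[].
Qed.

End zero_tuples.

Section test_functions.
Variables (R : realType) (k : nat).

(** The sigma-algebra on [Rn] is generated by coordinates, while continuity refers to the topology
    of row vectors; writing an open sublevel set as a countable union of rational boxes connects the
    two. *)
Lemma measurable_row_continuous (G : 'rV[R]_k -> R) : continuous G ->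
  measurable_fun setT (fun x : Rn R k => G (\row_i x i)).
Proof.
move=> cG; apply/measurable_EFinP; apply: emeasurable_fun_lt => y.
under eq_set do rewrite lte_fin.
pose box_at (ce : {ffun 'I_k -> rat} * rat) : set (Rn R k) :=
  [set x | forall i, `|x i - ratr (ce.1 i)| < ratr ce.2].
rewrite (_ : [set x | _] =
    \bigcup_(ce in [set ce | box_at ce `<=` [set x | G (\row_i x i) < y]]) box_at ce);
  last first.
  apply/seteqP; split => [x /= Gx|x [ce /= H] /H//].
  have : \forall z \near (\row_i x i), G z < y.
    by have /cvgr_lt/(_ y Gx) := cG (\row_i x i).
  move=> /nbhs_ballP[e /= e0 He].
  (* Two points of a box of radius [q] are within [2 q < e] of each other. *)
  have [q /andP[q0 qe]] : exists q : rat, 0 < (ratr q : R) < e / 2.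
    have /rat_in_itvoo[q] : 0 < e / 2 by rewrite divr_gt0.
    by rewrite in_itv; exists q.
  have Hc i : exists c : rat, `|x i - ratr c| < ratr q.
    have /rat_in_itvoo[c] : x i - ratr q < x i + ratr q by rewrite ltrD2l gt0_cp.
    rewrite in_itv/= => /andP[c1 c2]; exists c.
    by rewrite ltr_norml; apply/andP; split; lra.
  have [c Hcx] := choice Hc.
  exists ([ffun i => c i], q) => /=; last by move=> i /=; rewrite ffunE.
  move=> z /= Hz; apply: He; split => // i j; rewrite !mxE /ball/=.
  have := Hz j; have := Hcx j; rewrite ffunE !ltr_norml => /andP[? ?] /andP[? ?].
  by apply/andP; split; lra.
rewrite bigcup_mkcond; apply: countable_bigcupT_measurable => // ce.
case: ifPn => // _.
rewrite (_ : box_at ce = \bigcap_(i in [set: 'I_k])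
    ((fun x : Rn R k => `|x i - ratr (ce.1 i)|) @^-1` [set` `]-oo, ratr ce.2[]));
  last first.
  apply/seteqP; split => x H i; first by move=> _ /=; rewrite in_itv; exact: H.
  by have /= := H i I; rewrite in_itv.
apply: fin_bigcap_measurable => // i _.
rewrite -[X in measurable X]setTI.
have mf : measurable_fun setT (fun x : Rn R k => `|x i - ratr (ce.1 i)|).
  apply: measurableT_comp => //; apply: measurable_funB; first exact: measurable_coord.
  exact: measurable_cst.
exact: mf.
Qed.

Lemma measurable_injective : measurable [set x : Rn R k | injective x].
Proof.
rewrite (_ : [set x | _] = \bigcap_(ij in [set ij : 'I_k * 'I_k | ij.1 != ij.2])
    ((fun x : Rn R k => x ij.1 - x ij.2) @^-1` ~` [set 0])); last first.
  apply/seteqP; split => x /= H.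
    move=> [i j] /= ij /eqP; rewrite subr_eq0 => /eqP /H E.
    by move: ij; rewrite E eqxx.
  move=> i j xij; apply/eqP/negPn/negP => ij.
  by apply: (H (i, j) ij) => /=; rewrite xij subrr.
apply: fin_bigcap_measurable; first exact: finite_finset.
move=> ij _; rewrite -[X in measurable X]setTI.
have mf : measurable_fun setT (fun x : Rn R k => x ij.1 - x ij.2).
  by apply: measurable_funB; exact: measurable_coord.
by apply: mf => //; apply: measurableC.
Qed.

Lemma bounded_test_function (G : 'rV[R]_k -> R) : cont_compact_supp G ->
  exists2 M : R, 0 <= M & forall x, `|G x| <= M.
Proof.
move=> [cG kG].
have : compact (G @` closure [set x | G x != 0]).
  by apply: continuous_compact => //; exact: continuous_subspaceT.
move=> /compact_bounded[M [_ HM]].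
have M1 : M < `|M| + 1 by rewrite (le_lt_trans (ler_norm M))// ltrDl.
exists (`|M| + 1) => [|x]; first by rewrite addr_ge0.
have [->|Gx] := eqVneq (G x) 0; first by rewrite normr0 addr_ge0.
apply: (HM _ M1); exists x => //; exact: subset_closure.
Qed.

End test_functions.

(** * The correlation function *)

Section correlation.
Variables (R : realType) (mu : {measure set (measurableTypeR R) -> \bar R}).
Hypothesis hmom : forall m : nat, mu.-integrable setT (fun x : R => (x ^+ m)%:E).
Variable p : nat -> {poly R}.
Hypothesis hdeg : forall i : nat, size (p i) = i.+1.
Hypothesis hlead : forall i : nat, 0 < lead_coef (p i).
Hypothesis horth : forall i j : nat,
  ip mu (fun y => (p i).[y]) (fun y => (p j).[y]) = (i == j)%:R.
Variables (n k : nat) (hk1 : (1 <= k)%N) (hkn : (k <= n)%N).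
Variables (d : measure_display) (Omega : measurableType d) (P : probability Omega R).
Variables (xi : nat -> Omega -> R) (f : nat -> R -> R).
Hypothesis hxi_meas : forall i, (i <= n)%N -> measurable_fun setT (xi i).
Hypothesis hf_meas : forall i, (i <= n)%N -> measurable_fun setT (f i).
Hypothesis hf_ge0 : forall i, (i <= n)%N -> forall y, 0 <= f i y.
Hypothesis hdens : forall i, (i <= n)%N -> forall A : set R, measurable A ->
     P (xi i @^-1` A) = (\int[@lebesgue_measure R]_(y in A) (f i y)%:E)%E.
Hypothesis hindep : forall A : nat -> set R, (forall i, measurable (A i)) ->
     P (\bigcap_(i in [set i : nat | (i <= n)%N]) (xi i @^-1` A i))
     = (\prod_(i < n.+1) P (xi i @^-1` A i))%E.

Let C := monomial_coef mu p.
Let m := (n - k).+1.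

(** Keeps the part of the Jacobian that depends on [t]; the Vandermonde part goes into [const]. *)
Let weight (x : Rn R k) (t : Rn R m) : R :=
  joint_pdf f (tri C (coefs n.+1 (zpoly x * polyf t))) *
  \prod_(i < k) `|(polyf t).[x i]|.

Let const (x : Rn R k) : R :=
  \prod_(i < n.+1) C i i * \prod_(i < k) \prod_(j < k | (i < j)%N) `|x i - x j|.

Let weight_ge0 x t : 0 <= weight x t.
Proof. by rewrite mulr_ge0 ?joint_pdf_ge0// prodr_ge0. Qed.

Let C_gt0 i : 0 < C i i.
Proof. by rewrite /C monomial_coef_diag// invr_gt0. Qed.

Let const_ge0 x : 0 <= const x.
Proof.
by rewrite mulr_ge0// prodr_ge0// => i _; [exact: ltW|rewrite prodr_ge0].
Qed.

Let measurable_pdf_tri d' (T : measurableType d') (a : T -> Rn R n.+1) :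
  measurable_fun setT a -> measurable_fun setT (fun u => joint_pdf f (tri C (a u))).
Proof.
move=> ma; apply: (measurableT_comp (measurable_joint_pdf hf_meas)).
by apply: (@measurable_tri _ _ _ _ (fun i l => cst (C i l))) => // *; exact: measurable_cst.
Qed.

Let measurable_weight d' (T : measurableType d') (x : T -> Rn R k) (t : T -> Rn R m) :
  measurable_fun setT x -> measurable_fun setT t ->
  measurable_fun setT (fun u => weight (x u) (t u)).
Proof.
move=> mx mt; apply: measurable_funM.
  by apply: measurable_pdf_tri; exact: measurable_coefs_zpoly.
apply: measurable_prod => i _; apply: measurableT_comp => //.
apply: measurable_horner_polyf => //.
exact: (measurableT_comp (measurable_coord i) mx).
Qed.

Let measurable_const : measurable_fun setT const.
Proof.
apply: measurable_funM; first exact: measurable_cst.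
apply: measurable_prod => i _; under eq_fun do rewrite big_mkcond.
apply: measurable_prod => j _; case: (i < j)%N; last exact: measurable_cst.
apply: measurableT_comp => //; apply: measurable_funB; exact: measurable_coord.
Qed.

Let rho (x : Rn R k) : \bar R := rho_formula mu p f n (\row_i x i).

Let rhoE x : rho x = ((const x)%:E * iint (fun t => (weight x t)%:E))%E.
Proof.
rewrite /rho /rho_formula row_ord0 /const; congr ((_ * _)%:E * _)%E.
  by apply: eq_bigr => i _; rewrite -(monomial_coef_diag hmom hdeg hlead horth).
apply: eq_iint => t; congr (_ * _)%:E.
  apply: eq_bigr => l _; congr (f l _).
  rewrite big_geq_mkord /tri; apply: eq_bigr => i _.
  by rewrite /coefs coef_zpoly_polyf mulrC.
by apply: eq_bigr => i _; rewrite horner_polyf.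
Qed.

Let iint_weight_ge0 x : (0 <= iint (fun t => (weight x t)%:E))%E.
Proof. by apply: iint_ge0 => t; rewrite lee_fin. Qed.

Let rho_ge0 x : (0 <= rho x)%E.
Proof. by rewrite rhoE mule_ge0// lee_fin. Qed.

Let measurable_rho : measurable_fun setT rho.
Proof.
rewrite (_ : rho = fun x => (const x)%:E * iint (fun t => (weight x t)%:E))%E; last first.
  by apply/funext => x; rewrite rhoE.
apply: emeasurable_funM; first exact/measurable_EFinP.
apply: (@measurable_iint _ _ _ m (fun x t => (weight x t)%:E)).
by apply/measurable_EFinP; exact: measurable_weight.
Qed.

Let root_sum (g : Rn R k -> R) (w : Omega) : \bar R :=
  tsum (rootsR (randpoly n xi p w)) (EFin \o g).

Let measurable_tsum_pcomb (g : Rn R k -> R) : measurable_fun setT g ->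
  measurable_fun setT (fun t : Rn R n.+1 => tsum (rootsR (pcomb p t)) (EFin \o g)).
Proof.
move=> mg; under eq_fun => t do rewrite -(polyfK (size_pcomb hdeg t)).
apply: (measurable_tsum (F := fun _ x => (g x)%:E)).
  exact: measurable_coefs_pcomb.
by apply/measurable_EFinP; exact: (measurableT_comp mg measurable_snd).
Qed.

Let measurable_root_sum g : measurable_fun setT g -> measurable_fun setT (root_sum g).
Proof.
move=> mg.
exact: (measurableT_comp (measurable_tsum_pcomb mg) (measurable_xivec hxi_meas)).
Qed.

Let root_sum_ge0 g w : (forall x, 0 <= g x) -> (0 <= root_sum g w)%E.
Proof. by move=> g0; apply: tsum_ge0 => x; rewrite lee_fin. Qed.

(** The correlation identity for nonnegative test functions, with [+oo] allowed on both sides.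
    Vanishing on non-injective tuples is what permits dividing out the roots. *)
Lemma expected_root_sum (g : Rn R k -> R) : measurable_fun setT g ->
  (forall x, 0 <= g x) -> (forall x, ~ injective x -> g x = 0) ->
  (\int[P]_w root_sum g w = iint (fun x => (g x)%:E * rho x))%E.
Proof.
move=> mg g0 ginj.
have g0' x : (0 <= (g x)%:E)%E by rewrite lee_fin.
pose F (t : Rn R n.+1) := tsum (rootsR (pcomb p t)) (EFin \o g).
rewrite -[LHS]/(\int[P]_w F (xivec xi w : Rn R n.+1))%E.
rewrite (joint_density hxi_meas hf_meas hf_ge0 hdens hindep); last 2 first.
- exact: measurable_tsum_pcomb.
- by move=> t; exact: tsum_ge0.
have pdf0 := joint_pdf_ge0 hf_ge0.
(* Passes from coordinates in the basis [p] to monomial coefficients; the determinant becomes the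
   first factor of [const]. *)
rewrite (@tri_subst R n.+1 C); last 3 first.
- by move=> i _; exact: C_gt0.
- apply: emeasurable_funM; first exact: measurable_tsum_pcomb.
  by apply/measurable_EFinP; exact: measurable_joint_pdf.
- by move=> t; rewrite mule_ge0// ?lee_fin//; exact: tsum_ge0.
pose H (x : Rn R k) (a : Rn R n.+1) : \bar R := ((g x)%:E * (joint_pdf f (tri C a))%:E)%E.
under eq_iint => a do rewrite /F (pcomb_tri hmom hdeg hlead horth) -tsumZr//.
have mH : measurable_fun [set: Rn R k * Rn R n.+1] (fun z => H z.1 z.2).
  apply: emeasurable_funM; apply/measurable_EFinP.
    exact: (measurableT_comp mg measurable_fst).
  exact: measurable_pdf_tri.
rewrite (@roots_change_of_variables R k m n.+1 H)//; last 3 first.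
- by rewrite /m addnS subnKC.
- by move=> x a; rewrite mule_ge0// lee_fin.
- by move=> x a /ginj; rewrite /H => ->; rewrite mul0e.
rewrite -iintZl; last 3 first.
- apply: (@measurable_iint _ _ _ m (fun x t =>
    H x (coefs n.+1 (zpoly x * polyf t)) * (jac x t)%:E)%E).
  apply: emeasurable_funM.
    by apply: (measurable_comp2 mH) => //; exact: measurable_coefs_zpoly.
  by apply/measurable_EFinP; exact: measurable_jac.
- move=> x; apply: iint_ge0 => t.
  by rewrite !mule_ge0// lee_fin// jac_ge0.
- by rewrite prodr_ge0// => i _; exact: ltW.
apply: eq_iint => x; rewrite rhoE.
pose V := \prod_(i < k) \prod_(j < k | (i < j)%N) `|x i - x j|.
have V0 : 0 <= V by rewrite prodr_ge0// => i _; rewrite prodr_ge0.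
transitivity ((\prod_(i < n.+1) C i i)%:E *
    iint (fun t => (g x * V)%:E * (weight x t)%:E))%E.
  congr (_ * _)%E; apply: eq_iint => t; rewrite /H /jac -/V /weight -!EFinM.
  by congr (_%:E); rewrite -!mulrA; congr (_ * _); rewrite mulrCA.
rewrite iintZl; last 3 first.
- apply/measurable_EFinP; apply: measurable_weight => //; exact: measurable_cst.
- by move=> t; rewrite lee_fin.
- by rewrite mulr_ge0.
by rewrite muleA -EFinM muleA -EFinM /const -/V mulrCA.
Qed.

Let integrable_root_sum (g : Rn R k -> R) (M : R) :
  measurable_fun setT g -> (forall x, 0 <= g x <= M) ->
  P.-integrable setT (root_sum g).
Proof.
move=> mg gM.
have g0 x : 0 <= g x by case/andP: (gM x).
have M0 : 0 <= M by case/andP: (gM (fun=> 0)) => /le_trans; exact.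
apply/integrableP; split; first exact: measurable_root_sum.
(* A polynomial of size at most [n.+1] has at most [n.+1] real roots, hence at most [n.+1 ^ k]
   tuples, each contributing at most [M]. *)
pose B := (M *+ (n.+1 ^ k)).
apply: (@le_lt_trans _ _ (\int[P]_w (cst B%:E) w)%E); last first.
  have -> := integral_cst P measurableT B%:E.
  rewrite [X in (_ * X)%E](_ : _ = 1%E); last exact: probability_setT.
  by rewrite mule1 ltry.
apply: ge0_le_integral => //.
  by apply: measurableT_comp => //; exact: measurable_root_sum.
move=> w _; rewrite gee0_abs ?root_sum_ge0// /root_sum tsum_tuples sumEFin lee_fin.
have sz : (size (rootsR (randpoly n xi p w)) <= n.+1)%N.
  by apply: size_rootsR; exact: (size_pcomb hdeg (xivec xi w : Rn R n.+1)).
apply: (@le_trans _ _ (M *+ size (tuples_of k (rootsR (randpoly n xi p w))))).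
  rewrite -sum1_size -sumrMnr; apply: ler_sum => x _.
  by case/andP: (gM (x ord0)).
by apply: ler_wpMn2l => //; rewrite size_tuples_of leq_exp2r.
Qed.

Lemma correlation : @is_k_correlation R d Omega P n k xi p
  (fun x => if `[< injective (x ord0) >] then @rho_formula R mu p f n k x else 0%E).
Proof.
move=> G cG; have [M M0 GM] := bounded_test_function cG.
(* Injectivity moves from the sum over zeros into the test function; continuity may be lost, but
   measurability and the bound survive. *)
pose g (x : Rn R k) : R := if `[< injective x >] then G (\row_i x i) else 0.
pose gp x := Num.max (g x) 0; pose gm x := Num.max (- g x) 0.
have mg : measurable_fun setT g.
  apply: measurable_fun_ifT; last exact: measurable_cst.
    apply: (measurable_fun_bool true); rewrite setTI.
    rewrite (_ : _ @^-1` _ = [set x : Rn R k | injective x]).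
      exact: measurable_injective.
    by apply/seteqP; split=> x /= /asboolP.
  by apply: measurable_row_continuous; case: cG.
have mgp : measurable_fun setT gp.
  by apply: measurable_maxr => //; exact: measurable_cst.
have mgm : measurable_fun setT gm.
  by apply: measurable_maxr; [exact: measurableT_comp|exact: measurable_cst].
have gM x : `|g x| <= M by rewrite /g; case: ifP => // _; rewrite normr0.
have gpM x : 0 <= gp x <= M.
  by rewrite /gp le_max lexx orbT ge_max M0 (le_trans (ler_norm _)).
have gmM x : 0 <= gm x <= M.
  by rewrite /gm le_max lexx orbT ge_max M0 (le_trans (ler_norm _))// normrN.
have gp0 x : 0 <= gp x by case/andP: (gpM x).
have gm0 x : 0 <= gm x by case/andP: (gmM x).
have gE x : gp x - gm x = g x.
  by rewrite /gp /gm; case: (leP (g x) 0) => g0; case: (leP (- g x) 0) => g1; lra.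
have gpinj x : ~ injective x -> gp x = 0.
  by move=> ni; rewrite /gp /g; case: asboolP => // _; rewrite maxxx.
have gminj x : ~ injective x -> gm x = 0.
  by move=> ni; rewrite /gm /g; case: asboolP => // _; rewrite oppr0 maxxx.
have ip := integrable_root_sum mgp gpM.
have im := integrable_root_sum mgm gmM.
(* Finiteness is known for the expectation, and [expected_root_sum] carries it to the iterated
   integral, where the subtraction requires it. *)
have fin (h : Rn R k -> R) : measurable_fun setT h -> (forall x, 0 <= h x) ->
    (forall x, ~ injective x -> h x = 0) -> P.-integrable setT (root_sum h) ->
    (iint (fun x => (h x)%:E * rho x) < +oo)%E.
  move=> mh h0 hinj /integrableP[_]; rewrite -expected_root_sum//.
  by under eq_integral do rewrite gee0_abs ?root_sum_ge0//.
transitivity (\int[P]_w (root_sum gp w - root_sum gm w))%E.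
  apply: eq_integral => w _; rewrite sum_over_zero_tuplesE// /root_sum !tsum_tuples.
  rewrite !sumEFin -EFinB -sumrB big_mkcond; congr (_%:E); apply: eq_bigr => x _.
  rewrite gE /g; case: ifP => // _; congr G.
  by apply/rowP => i; rewrite mxE.
rewrite integralB// !expected_root_sum//.
rewrite -iintB; last 6 first.
- by apply: emeasurable_funM => //; exact/measurable_EFinP.
- by apply: emeasurable_funM => //; exact/measurable_EFinP.
- by move=> x; rewrite mule_ge0// lee_fin.
- by move=> x; rewrite mule_ge0// lee_fin.
- exact: fin.
- exact: fin.
apply: eq_iint => x; rewrite row_ord0 -/(rho x).
case: asboolP => [ix|ni]; last by rewrite gpinj// gminj// !mul0e sube0 mule0.
have gx : g x = G (\row_i x i) by rewrite /g; case: asboolP.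
(* One of [gp x] and [gm x] is zero, so the difference is never of the form [+oo - +oo], even where
   [rho x] is infinite. *)
rewrite -gx; have [g0|g0] := leP 0 (g x).
  have -> : gp x = g x by apply/max_idPl.
  have -> : gm x = 0 by apply/max_idPr; rewrite oppr_le0.
  by rewrite mul0e sube0.
have -> : gp x = 0 by apply/max_idPr; exact: ltW.
have -> : gm x = - g x by apply/max_idPl; rewrite oppr_ge0 ltW.
by rewrite mul0e sub0e EFinN mulNe oppeK.
Qed.

End correlation.

Theorem theorem12p2
  (R : realType)
  (* the measure mu on R, with all moments finite *)
  (mu : {measure set (measurableTypeR R) -> \bar R})
  (hmom : forall m : nat, mu.-integrable setT (fun x : R => (x ^+ m)%:E))
  (* orthonormal polynomials p_i = gamma_i x^i + ..., gamma_i > 0 *)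
  (p : nat -> {poly R})
  (hdeg : forall i : nat, size (p i) = i.+1)
  (hlead : forall i : nat, 0 < lead_coef (p i))
  (horth : forall i j : nat,
     ip mu (fun y => (p i).[y]) (fun y => (p j).[y]) = (i == j)%:R)
  (* 1 <= k <= n *)
  (n k : nat) (hk1 : (1 <= k)%N) (hkn : (k <= n)%N)
  (* independent real random variables xi_0..xi_n with densities f_0..f_n *)
  (d : measure_display) (Omega : measurableType d) (P : probability Omega R)
  (xi : nat -> Omega -> R) (f : nat -> R -> R)
  (hxi_meas : forall i, (i <= n)%N -> measurable_fun setT (xi i))
  (hf_meas : forall i, (i <= n)%N -> measurable_fun setT (f i))
  (hf_ge0 : forall i, (i <= n)%N -> forall y, 0 <= f i y)
  (hdens : forall i, (i <= n)%N -> forall A : set R, measurable A ->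
     P (xi i @^-1` A) = (\int[@lebesgue_measure R]_(y in A) (f i y)%:E)%E)
  (hindep : forall A : nat -> set R, (forall i, measurable (A i)) ->
     P (\bigcap_(i in [set i : nat | (i <= n)%N]) (xi i @^-1` A i))
     = (\prod_(i < n.+1) P (xi i @^-1` A i))%E) :
  @is_k_correlation R d Omega P n k xi p
    (fun x => if `[< injective (x ord0) >] then @rho_formula R mu p f n k x else 0%E).
Proof. exact: correlation. Qed.
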